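(* Let $\alpha>0$, $M>0$, let $U,T$ be the base-flow profiles described in the context, and let $c_0$ be a simple trapped rigid-wall eigenvalue (in the sense of the context) with eigenfunction $\hat p_0$ and sensitivity coefficient $K=\dfrac{i\alpha\hat p_0(0)^2}{c_0 I}$. Let $c(A)$ be the analytic eigenvalue branch with $c(0)=c_0$ and let $\delta\sigma=\alpha\operatorname{Im}(c(A)-c_0)$. Write $A=|A|e^{i\varphi}$ with $A\ne0$ and $K=|K|e^{i\varphi_K}$. Then, to first order in $|A|$ (i.e. up to $\mathcal O(|A|^2)$), $$\delta\sigma=\alpha|K||A|\sin(\varphi+\varphi_K),$$ and the admittance stabilises the mode (i.e. this first-order shift is negative) if and only if $\operatorname{Im}(Ke^{i\varphi})<0$, i.e. if and only if $\varphi\in(-\pi-\varphi_K,\,-\varphi_K)$ modulo $2\pi$.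
   Context: Base flow: $U,T:[0,\infty)\to\mathbb{R}$ are smooth on $[0,y_b]$, $T>0$, $U(0)=0$, $T_w:=T(0)$, and $U=T=1$ for $y\ge y_b$, for some $y_b>0$. Compressible Rayleigh equation with complex phase speed $c$: $(\Phi\hat p')'=\alpha^2(\Phi-M^2)\hat p$, $\Phi(y;c)=T/(U-c)^2$. Let $\gamma(c)=\alpha[1-M^2(1-c)^2]^{1/2}$, the analytic branch near $c_0$ with $\operatorname{Re}\gamma(c_0)>0$ (''trapped''). Let $P(y;c)$ solve the Rayleigh equation on $[0,y_b]$ with $P(y_b;c)=1$, $P'(y_b;c)=-\gamma(c)$, and let $$D(c,A)=P'(0;c)+\frac{i\alpha cA}{T_w}P(0;c),$$ whose zeros $c$ are the eigenvalues of the problem with wall condition $\hat p'(0)=-(i\alpha cA/T_w)\hat p(0)$, $A\in\mathbb{C}$ being the wall admittance. A simple trapped rigid-wall eigenvalue is $c_0$ with $D(c_0,0)=0$, $D_c(c_0,0)\ne0$, $\operatorname{Re}\gamma(c_0)>0$, having a neighbourhood free of sonic branch points (zeros of $1-M^2(1-c)^2$) and of critical singularities ($U(y)=c$ for some $y\in[0,y_b]$); if a critical point is present on the real axis, the path $[0,y_b]$ is indented around it in the complex $y$-plane (with $U,T$ continued analytically) on the side obtained by continuation from $\operatorname{Im}c>0$. The eigenfunction $\hat p_0$ is any nonzero multiple of $P(\cdot;c_0)$. The branch $c(A)$ is the unique analytic function near $A=0$ with $D(c(A),A)=0$, $c(0)=c_0$. With $\gamma_0=\gamma(c_0)$, $$I=\int_0^{y_b}\frac{2T}{(U-c_0)^3}\big(\hat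 p_0'^{\,2}+\alpha^2\hat p_0^{\,2}\big)\,dy+\frac{2}{(1-c_0)^3}\,\frac{(\gamma_0^2+\alpha^2)\hat p_0(y_b)^2}{2\gamma_0}.$$ The growth rate of a mode is $\sigma=\alpha\operatorname{Im}c$. *)

(* Defs.v *)
From Stdlib Require Import Reals.
From Coquelicot Require Import Coquelicot.

Open Scope R_scope.
Open Scope C_scope.

Definition cis (phi : R) : C := (cos phi, sin phi).

(* [z = |z| e^{i phi}]; every real [phi] is a phase of [0]. *)
Definition is_phase (z : C) (phi : R) : Prop := z = RtoC (Cmod z) * cis phi.

Definition analytic_at (f : C -> C) (z0 : C) : Prop :=
  exists a : nat -> C,
    locally (T := C_UniformSpace) z0 (fun z =>
      is_pseries (K := C_AbsRing) (V := C_NormedModule) a (z - z0) (f z)).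

(* Smoothness on a closed interval, one-sided at the end points, expressed by
   a smooth extension. *)
Definition smooth_on (a b : R) (f : R -> R) : Prop :=
  exists g : R -> R,
    (forall (n : nat) (x : R), ex_derive_n g n x) /\
    (forall x : R, (a <= x <= b)%R -> g x = f x).

(* Derivative at [s] relative to the interval [[a, b]]: two-sided inside,
   one-sided at the end points. *)
Definition is_derive_on (a b : R) (f : R -> C) (s : R) (l : C) : Prop :=
  filterdiff (K := R_AbsRing) (U := R_NormedModule) (V := C_R_NormedModule) f
    (within (fun x => (a <= x <= b)%R) (locally s)) (fun h => scal h l).

Record base_flow (yb : R) (U T : R -> R) : Prop := {
  flow_yb : (0 < yb)%R;
  flow_U_smooth : smooth_on 0 yb U;
  flow_T_smooth : smooth_on 0 yb T;
  flow_T_pos : forall y : R, (0 <= y)%R -> (0 < T y)%R;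
  flow_U_wall : U 0%R = 0%R;
  flow_U_free : forall y : R, (yb <= y)%R -> U y = 1%R;
  flow_T_free : forall y : R, (yb <= y)%R -> T y = 1%R
}.

(* The Rayleigh equation lives on a path [eta : [0, yb] -> C] from [0] to [yb]
   in the complex y-plane, with velocity [deta]. [Uc], [Tc] are complex
   functions extending [U], [T] from the real segment. *)

Definition extends (yb : R) (f : R -> R) (fc : C -> C) : Prop :=
  forall y : R, (0 <= y <= yb)%R -> fc (RtoC y) = RtoC (f y).

Definition segment_contour (yb : R) (eta deta : R -> C) : Prop :=
  forall s : R, (0 <= s <= yb)%R -> eta s = RtoC s /\ deta s = RtoC 1.

(* An indentation is the final stage [H 1] of a deformation [H] of the real
   segment with fixed end points. Wherever the segment moves, it moves inside
   an open set [Om] on which the profiles are analytic and [Tc] has no zero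
   (a zero of [Tc] would be a singular point of the equation, [Phi] vanishing
   there). The velocity of [H 1] may vanish, so a path with corners, such as a
   segment with a semicircular detour, is covered after slowing down the
   parametrization at the corners.
   The side of the indentation is fixed by the last condition: for [Im c > 0]
   close to [c0], no critical point [U = c] is met by the deformation, so that
   the equation on [H 1] is the continuation of the equation on the real
   segment from [Im c > 0]. *)
Definition indented_contour (yb : R) (Uc Tc : C -> C) (c0 : C)
    (eta deta : R -> C) : Prop :=
  (forall s : R, (0 <= s <= yb)%R -> is_derive_on 0 yb eta s (deta s)) /\
  continuous_on (T := R_UniformSpace) (U := C_UniformSpace)
    (fun s => (0 <= s <= yb)%R) deta /\
  exists (Om : C -> Prop) (H : R -> R -> C),
    open (T := C_UniformSpace) Om /\
    (forall z : C, Om z -> analytic_at Uc z /\ analytic_at Tc z /\ Tc z <> 0) /\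
    continuous_on
      (T := prod_UniformSpace R_UniformSpace R_UniformSpace)
      (U := C_UniformSpace)
      (fun q => (0 <= fst q <= 1)%R /\ (0 <= snd q <= yb)%R)
      (fun q => H (fst q) (snd q)) /\
    (forall t : R, (0 <= t <= 1)%R -> H t 0%R = 0 /\ H t yb = RtoC yb) /\
    (forall s : R, (0 <= s <= yb)%R ->
      (exists y : R, (0 <= y <= yb)%R /\ H 0%R s = RtoC y) /\
      H 1%R s = eta s) /\
    (forall s : R, (0 <= s <= yb)%R ->
      (forall t : R, (0 <= t <= 1)%R -> Om (H t s)) \/
      locally s (fun s' : R => (0 <= s' <= yb)%R ->
        forall t : R, (0 <= t <= 1)%R -> H t s' = H 0%R s')) /\
    locally (T := C_UniformSpace) c0 (fun c => (0 < Im c)%R ->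
      forall t s : R, (0 <= t <= 1)%R -> (0 <= s <= yb)%R -> Uc (H t s) <> c).

Definition contour (yb : R) (U : R -> R) (Uc Tc : C -> C) (c0 : C)
    (eta deta : R -> C) : Prop :=
  ((forall y : R, (0 <= y <= yb)%R -> RtoC (U y) <> c0) /\
   segment_contour yb eta deta) \/
  ((exists y : R, (0 <= y <= yb)%R /\ RtoC (U y) = c0) /\
   indented_contour yb Uc Tc c0 eta deta).

Definition Phi (Uc Tc : C -> C) (c y : C) : C := Tc y / (Uc y - c) ^ 2.

(* [p] and [dp] are the values of the solution and of its y-derivative along
   the contour, as functions of the contour parameter. *)
Definition rayleigh_solution (alpha M yb : R) (Uc Tc : C -> C)
    (eta deta : R -> C) (c : C) (p dp : R -> C) : Prop :=
  forall s : R, (0 <= s <= yb)%R ->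
    is_derive_on 0 yb p s (dp s * deta s) /\
    is_derive_on 0 yb (fun x => Phi Uc Tc c (eta x) * dp x) s
      (RtoC alpha ^ 2 * (Phi Uc Tc c (eta s) - RtoC M ^ 2) * p s * deta s).

Definition sonic (M : R) (c : C) : C := 1 - RtoC M ^ 2 * (1 - c) ^ 2.

Definition gamma_branch (alpha M : R) (c0 : C) (gamma : C -> C) : Prop :=
  exists r : C -> C,
    analytic_at r c0 /\
    locally (T := C_UniformSpace) c0 (fun c =>
      r c ^ 2 = sonic M c /\ gamma c = RtoC alpha * r c) /\
    (0 < Re (gamma c0))%R.

Definition decaying_solutions (alpha M yb : R) (Uc Tc : C -> C)
    (eta deta : R -> C) (gamma : C -> C) (c0 : C) (P dP : C -> R -> C) : Prop :=
  locally (T := C_UniformSpace) c0 (fun c =>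
    rayleigh_solution alpha M yb Uc Tc eta deta c (P c) (dP c) /\
    P c yb = 1 /\ dP c yb = - gamma c).

Definition dispersion (alpha Tw : R) (P dP : C -> R -> C) (c A : C) : C :=
  dP c 0%R + Ci * RtoC alpha * c * A / RtoC Tw * P c 0%R.

Record simple_trapped_eigenvalue (alpha M yb : R) (U T : R -> R)
    (Uc Tc : C -> C) (eta deta : R -> C) (gamma : C -> C)
    (P dP : C -> R -> C) (c0 : C) : Prop := {
  eig_contour : contour yb U Uc Tc c0 eta deta;
  eig_regular : locally (T := C_UniformSpace) c0 (fun c =>
    sonic M c <> 0 /\
    forall s : R, (0 <= s <= yb)%R -> Uc (eta s) <> c);
  eig_gamma : gamma_branch alpha M c0 gamma;
  eig_solutions :
    decaying_solutions alpha M yb Uc Tc eta deta gamma c0 P dP;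
  eig_zero : dispersion alpha (T 0%R) P dP c0 0 = 0;
  eig_simple : exists d : C,
    is_derive (K := C_AbsRing) (V := C_NormedModule)
      (fun c : C => dispersion alpha (T 0%R) P dP c 0) c0 d /\
    d <> 0
}.

Definition is_eigenfunction (yb : R) (P dP : C -> R -> C) (c0 : C)
    (p0 dp0 : R -> C) : Prop :=
  exists k : C, k <> 0 /\
    forall s : R, (0 <= s <= yb)%R ->
      p0 s = k * P c0 s /\ dp0 s = k * dP c0 s.

Definition eigenvalue_branch (Dfun : C -> C -> C) (c0 : C) (cA : C -> C) : Prop :=
  analytic_at cA 0 /\ cA 0 = c0 /\
  locally (T := C_UniformSpace) (RtoC 0) (fun A => Dfun (cA A) A = 0).

Definition sens_I (alpha yb : R) (Uc Tc : C -> C) (eta deta : R -> C)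
    (c0 gamma0 : C) (p0 dp0 : R -> C) : C :=
  RInt (V := C_R_CompleteNormedModule)
    (fun s : R =>
       2 * Tc (eta s) / (Uc (eta s) - c0) ^ 3 *
       (dp0 s ^ 2 + RtoC alpha ^ 2 * p0 s ^ 2) * deta s) 0%R yb +
  2 / (1 - c0) ^ 3 *
    ((gamma0 ^ 2 + RtoC alpha ^ 2) * p0 yb ^ 2 / (2 * gamma0)).

Definition sens_K (alpha : R) (c0 I : C) (p0 : R -> C) : C :=
  Ci * RtoC alpha * p0 0%R ^ 2 / (c0 * I).

(* Main.v *)
(** Write [q = Phi * dp], so that the Rayleigh equation becomes the linear system
[p' = a q], [q' = b p] on the contour parameter, with [a], [b] depending
smoothly on [c]. For two phase speeds [c], [c0] the Wronskian
[W = q_c p_0 - q_0 p_c] satisfies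
[W' = (b_c - b_0) p_c p_0 - (a_c - a_0) q_c q_0]; integrating it, dividing by
[c - c0] and using continuous dependence (Gronwall) gives
[T_w / c0^2 * D_c(c0, 0) * p_0(0) = - I], where the boundary term of [I] is the
derivative of the flux [- gamma / (1 - c)^2] at [y_b]. Differentiating
[D(c(A), A) = 0] at [A = 0] then yields [c'(0) = K], and simplicity of the
eigenvalue together with uniqueness for the linear system gives [K <> 0], which
the sector criterion needs. *)

Require Import Defs.
From Stdlib Require Import Reals.
From Coquelicot Require Import Coquelicot.
From Stdlib Require Import Lra Lia.

Open Scope R_scope.

(** The family [P] is given one phase speed at a time: apart from the derivative [d] in
    [eig_simple], whose value is unknown, no regularity in [c] is assumed, so it has to be extracted
    from the equation and from the data at [y_b]. Two facts keep this extraction small. The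
    rigid-wall condition makes the flux [q_0] vanish at the wall, so the Wronskian there is just
    [q_c p_0], and its tangent yields that of [dP c 0] without any derivative of [p] in [c]. And
    [P c 0] enters the dispersion function multiplied by [A], which vanishes at the base point, so a
    Lipschitz bound for it suffices. Differentiability is carried as an explicit quadratic bound on
    a disc. This notion is stable under sums, products, inverses and composition, it follows from a
    convergent power series, and for the branch [cA] it is already the error estimate that the
    theorem claims. *)

Lemma locally_Cmod (z0 : C) (Q : C -> Prop) :
  locally (T := C_UniformSpace) z0 Q ->
  exists r, 0 < r /\ forall z, Cmod (z - z0) < r -> Q z.
Proof.
  intros [eps H]; exists eps; split; [apply cond_pos |].
  intros z Hz; apply H, C_NormedModule_mixin_compat1, Hz.
Qed.

(** * Calculus of tangents with quadratic remainder *)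

(* Complex differentiability with a quadratic remainder, which is what turns
   first-order statements into O(|A|^2) bounds. *)
Definition has_tangent (f : C -> C) (z0 l : C) : Prop :=
  exists B r, 0 < r /\ forall z, Cmod (z - z0) < r ->
    Cmod (f z - f z0 - l * (z - z0)) <= B * Cmod (z - z0) ^ 2.

(** One nonnegative constant is made to serve both the remainder and the Lipschitz bound. On the
    disc |h| <= b, hence |B||h|^2 <= |B| b |h|; the [+ 1] in [b + 1] keeps the constant above |B| as
    well. *)
Lemma has_tangent_bounds (f : C -> C) (z0 l : C) (b : R) :
  has_tangent f z0 l -> 0 < b ->
  exists B r, 0 <= B /\ 0 < r <= b /\ forall z, Cmod (z - z0) < r ->
    Cmod (f z - f z0 - l * (z - z0)) <= B * Cmod (z - z0) ^ 2 /\
    Cmod (f z - f z0) <= B * Cmod (z - z0).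
Proof.
  intros [B [r [Hr H]]] Hb.
  pose proof (Rabs_pos B) as HB; pose proof (Cmod_ge_0 l) as Hl.
  exists (Rabs B * (b + 1) + Cmod l), (Rmin r b).
  assert (0 <= Rabs B * b) by nra.
  split; [nra |]. split; [split; [apply Rmin_pos; lra | apply Rmin_r] |].
  intros z Hz.
  pose proof (Rmin_l r b); pose proof (Rmin_r r b).
  assert (Hz' : Cmod (z - z0) < r) by lra.
  specialize (H z Hz').
  pose proof (Cmod_ge_0 (z - z0)) as Hh.
  pose proof (Rle_abs B).
  assert (B * Cmod (z - z0) ^ 2 <= Rabs B * Cmod (z - z0) ^ 2)
    by (apply Rmult_le_compat_r; [apply pow2_ge_0 | lra]).
  split.
  - eapply Rle_trans; [exact H |].
    assert (0 <= Cmod (z - z0) ^ 2) by apply pow2_ge_0. nra.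
  - replace (f z - f z0)%C
      with ((f z - f z0 - l * (z - z0)) + l * (z - z0))%C by ring.
    eapply Rle_trans; [apply Cmod_triangle |]. rewrite Cmod_mult.
    assert (Rabs B * Cmod (z - z0) ^ 2 <= Rabs B * (b + 1) * Cmod (z - z0)).
    { replace (Rabs B * Cmod (z - z0) ^ 2)
        with (Cmod (z - z0) * (Rabs B * Cmod (z - z0))) by ring.
      replace (Rabs B * (b + 1) * Cmod (z - z0))
        with (Cmod (z - z0) * (Rabs B * (b + 1))) by ring.
      apply Rmult_le_compat_l; [lra |].
      apply Rmult_le_compat_l; lra. }
    nra.
Qed.

Lemma has_tangent_ext (f g : C -> C) (z0 l : C) (r : R) :
  0 < r -> (forall z, Cmod (z - z0) < r -> f z = g z) ->
  has_tangent f z0 l -> has_tangent g z0 l.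
Proof.
  intros Hr Heq [B [r' [Hr' H]]].
  exists B, (Rmin r r'); split; [apply Rmin_pos; lra |].
  intros z Hz. pose proof (Rmin_l r r'); pose proof (Rmin_r r r').
  rewrite <- (Heq z), <- (Heq z0); [apply H; lra | | lra].
  replace (z0 - z0)%C with (RtoC 0) by ring. rewrite Cmod_0; lra.
Qed.

Lemma has_tangent_const (k z0 : C) : has_tangent (fun _ => k) z0 0.
Proof.
  exists 0, 1; split; [lra |]; intros z _.
  replace (k - k - 0 * (z - z0))%C with (RtoC 0) by ring.
  rewrite Cmod_0; lra.
Qed.

Lemma has_tangent_id (z0 : C) : has_tangent (fun z => z) z0 1.
Proof.
  exists 0, 1; split; [lra |]; intros z _.
  replace (z - z0 - 1 * (z - z0))%C with (RtoC 0) by ring.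
  rewrite Cmod_0; lra.
Qed.

Lemma has_tangent_plus (f g : C -> C) (z0 l m : C) :
  has_tangent f z0 l -> has_tangent g z0 m ->
  has_tangent (fun z => f z + g z)%C z0 (l + m)%C.
Proof.
  intros [B [r [Hr H]]] [B' [r' [Hr' H']]].
  exists (B + B'), (Rmin r r'); split; [apply Rmin_pos; lra |].
  intros z Hz. pose proof (Rmin_l r r'); pose proof (Rmin_r r r').
  replace (f z + g z - (f z0 + g z0) - (l + m) * (z - z0))%C with
    ((f z - f z0 - l * (z - z0)) + (g z - g z0 - m * (z - z0)))%C by ring.
  eapply Rle_trans; [apply Cmod_triangle |].
  assert (Hz1 : Cmod (z - z0) < r) by lra.
  assert (Hz2 : Cmod (z - z0) < r') by lra.
  specialize (H z Hz1); specialize (H' z Hz2). lra.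
Qed.

Lemma has_tangent_mult (f g : C -> C) (z0 l m : C) :
  has_tangent f z0 l -> has_tangent g z0 m ->
  has_tangent (fun z => f z * g z)%C z0 (l * g z0 + f z0 * m)%C.
Proof.
  intros Hf Hg.
  destruct (has_tangent_bounds _ _ _ 1 Hf Rlt_0_1) as [B [r [HB [Hr H]]]].
  destruct (has_tangent_bounds _ _ _ 1 Hg Rlt_0_1) as [B' [r' [HB' [Hr' H']]]].
  exists (B * B' + B * Cmod (g z0) + Cmod (f z0) * B'), (Rmin r r').
  split; [apply Rmin_pos; lra |].
  intros z Hz. pose proof (Rmin_l r r'); pose proof (Rmin_r r r').
  destruct (H z) as [Hf1 Hf2]; [lra |]; destruct (H' z) as [Hg1 Hg2]; [lra |].
  replace (f z * g z - f z0 * g z0 - (l * g z0 + f z0 * m) * (z - z0))%C with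
    ((f z - f z0) * (g z - g z0) + (f z - f z0 - l * (z - z0)) * g z0
      + f z0 * (g z - g z0 - m * (z - z0)))%C by ring.
  eapply Rle_trans; [apply Cmod_triangle |].
  eapply Rle_trans; [apply Rplus_le_compat_r, Cmod_triangle |].
  rewrite !Cmod_mult.
  assert (E1 : Cmod (f z - f z0) * Cmod (g z - g z0)
    <= (B * Cmod (z - z0)) * (B' * Cmod (z - z0)))
    by (apply Rmult_le_compat; auto using Cmod_ge_0).
  assert (E2 : Cmod (f z - f z0 - l * (z - z0)) * Cmod (g z0)
    <= B * Cmod (z - z0) ^ 2 * Cmod (g z0))
    by (apply Rmult_le_compat_r; auto using Cmod_ge_0).
  assert (E3 : Cmod (f z0) * Cmod (g z - g z0 - m * (z - z0))
    <= Cmod (f z0) * (B' * Cmod (z - z0) ^ 2))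
    by (apply Rmult_le_compat_l; auto using Cmod_ge_0).
  nra.
Qed.

(** With h = z - z0 and k = |f z0|, the error equals (f z - f z0)^2 / (f z f(z0)^2) - (f z - f z0 -
    l h) / f(z0)^2, quadratic as soon as |f z| is bounded below. The radius enforces |f z - f z0| <=
    k/2, hence |f z| >= k/2. *)
Lemma has_tangent_inv (f : C -> C) (z0 l : C) :
  f z0 <> 0 -> has_tangent f z0 l ->
  has_tangent (fun z => / f z)%C z0 (- l / (f z0 * f z0))%C.
Proof.
  intros Hnz Hf.
  destruct (has_tangent_bounds _ _ _ 1 Hf Rlt_0_1) as [B [r [HB [Hr H]]]].
  pose proof (proj1 (Cmod_gt_0 _) Hnz) as Hp.
  set (k := Cmod (f z0)) in *.
  exists (B * B * / (k / 2 * (k * k)) + B * / (k * k)),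
    (Rmin r (k / 2 / (B + 1))).
  split; [apply Rmin_pos; [lra | apply Rdiv_lt_0_compat; lra] |].
  intros z Hz.
  pose proof (Rmin_l r (k / 2 / (B + 1))); pose proof (Rmin_r r (k / 2 / (B + 1))).
  destruct (H z) as [Hf1 Hf2]; [lra |].
  pose proof (Cmod_ge_0 (z - z0)) as Hh.
  assert (HBh : B * Cmod (z - z0) <= k / 2).
  { assert (Cmod (z - z0) * (B + 1) <= k / 2).
    { apply Rmult_le_reg_r with (/ (B + 1)); [apply Rinv_0_lt_compat; lra |].
      rewrite Rmult_assoc, Rinv_r by lra. unfold Rdiv in *; lra. }
    nra. }
  assert (Hlow : k / 2 <= Cmod (f z)).
  { assert (k <= Cmod (f z) + Cmod (f z - f z0)).
    { unfold k. replace (f z0) with (f z + - (f z - f z0))%C at 1 by ring.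
      eapply Rle_trans; [apply Cmod_triangle |]. rewrite Cmod_opp. lra. }
    lra. }
  assert (Hfz : f z <> 0) by (apply Cmod_gt_0; lra).
  replace (/ f z - / f z0 - - l / (f z0 * f z0) * (z - z0))%C with
    ((f z - f z0) * (f z - f z0) * / (f z * (f z0 * f z0))
      + - ((f z - f z0 - l * (z - z0)) * / (f z0 * f z0)))%C
    by (field; split; assumption).
  assert (Hk2 : (f z0 * f z0)%C <> 0) by (apply Cmult_neq_0; assumption).
  assert (Hk3 : (f z * (f z0 * f z0))%C <> 0) by (apply Cmult_neq_0; assumption).
  eapply Rle_trans; [apply Cmod_triangle |].
  rewrite Cmod_opp, !Cmod_mult, !Cmod_inv, !Cmod_mult by assumption. fold k.
  rewrite Rmult_plus_distr_r. apply Rplus_le_compat.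
  - replace (B * B * / (k / 2 * (k * k)) * Cmod (z - z0) ^ 2) with
      ((B * Cmod (z - z0)) * (B * Cmod (z - z0)) * / (k / 2 * (k * k))) by ring.
    assert (0 < k * k) by nra.
    apply Rmult_le_compat.
    + apply Rmult_le_pos; apply Cmod_ge_0.
    + left; apply Rinv_0_lt_compat. apply Rmult_lt_0_compat; lra.
    + apply Rmult_le_compat; auto using Cmod_ge_0.
    + apply Rinv_le_contravar; [apply Rmult_lt_0_compat; lra |].
      apply Rmult_le_compat_r; lra.
  - replace (B * / (k * k) * Cmod (z - z0) ^ 2)
      with (B * Cmod (z - z0) ^ 2 * / (k * k)) by ring.
    apply Rmult_le_compat_r; [| exact Hf1].
    left; apply Rinv_0_lt_compat; nra.
Qed.

Lemma has_tangent_comp (f g : C -> C) (z0 l m : C) :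
  has_tangent g z0 m -> has_tangent f (g z0) l ->
  has_tangent (fun z => f (g z)) z0 (l * m)%C.
Proof.
  intros Hg Hf.
  destruct (has_tangent_bounds _ _ _ 1 Hf Rlt_0_1) as [B [r [HB [Hr H]]]].
  destruct (has_tangent_bounds _ _ _ 1 Hg Rlt_0_1) as [B' [r' [HB' [Hr' H']]]].
  exists (B * B' ^ 2 + Cmod l * B'), (Rmin r' (r / (B' + 1))).
  split; [apply Rmin_pos; [lra | apply Rdiv_lt_0_compat; lra] |].
  intros z Hz.
  pose proof (Rmin_l r' (r / (B' + 1))); pose proof (Rmin_r r' (r / (B' + 1))).
  destruct (H' z) as [Hg1 Hg2]; [lra |].
  pose proof (Cmod_ge_0 (z - z0)) as Hh.
  assert (Hgz : Cmod (g z - g z0) < r).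
  { assert (Cmod (z - z0) * (B' + 1) < r).
    { apply Rmult_lt_reg_r with (/ (B' + 1)); [apply Rinv_0_lt_compat; lra |].
      rewrite Rmult_assoc, Rinv_r by lra. unfold Rdiv in *; lra. }
    nra. }
  destruct (H (g z) Hgz) as [Hf1 _].
  replace (f (g z) - f (g z0) - l * m * (z - z0))%C with
    ((f (g z) - f (g z0) - l * (g z - g z0))
      + l * (g z - g z0 - m * (z - z0)))%C by ring.
  eapply Rle_trans; [apply Cmod_triangle |]. rewrite Cmod_mult.
  rewrite Rmult_plus_distr_r. apply Rplus_le_compat.
  - eapply Rle_trans; [exact Hf1 |].
    rewrite Rmult_assoc, <- Rpow_mult_distr.
    apply Rmult_le_compat_l; [lra |].
    apply pow_incr; split; [apply Cmod_ge_0 | exact Hg2].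
  - rewrite Rmult_assoc. apply Rmult_le_compat_l; [apply Cmod_ge_0 | exact Hg1].
Qed.

(** Gives access to uniqueness of complex derivatives, and lets a computed tangent be compared with
    the plain derivative [d] in [eig_simple]. *)
Lemma has_tangent_is_derive (f : C -> C) (z0 l : C) :
  has_tangent f z0 l -> is_derive (K := C_AbsRing) (V := C_NormedModule) f z0 l.
Proof.
  intros Hf.
  destruct (has_tangent_bounds _ _ _ 1 Hf Rlt_0_1) as [B [r [HB [Hr H]]]].
  split; [apply is_linear_scal_l |].
  intros x Hx.
  assert (Hxz : z0 = x).
  { apply (is_filter_lim_locally_unique (K := C_AbsRing)
      (V := AbsRing_NormedModule C_AbsRing) z0 x), Hx. }
  subst x. intros eps.
  assert (Hd : 0 < Rmin r (eps / (B + 1))).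
  { apply Rmin_pos; [lra | apply Rdiv_lt_0_compat; [apply cond_pos | lra]]. }
  exists (mkposreal _ Hd). intros z Hz.
  change (Cmod (z - z0) < Rmin r (eps / (B + 1))) in Hz.
  change (Cmod (f z - f z0 - (z - z0) * l) <= eps * Cmod (z - z0)).
  pose proof (Rmin_l r (eps / (B + 1))); pose proof (Rmin_r r (eps / (B + 1))).
  destruct (H z) as [Hf1 _]; [lra |].
  replace (f z - f z0 - (z - z0) * l)%C
    with (f z - f z0 - l * (z - z0))%C by ring.
  eapply Rle_trans; [exact Hf1 |].
  pose proof (Cmod_ge_0 (z - z0)) as Hh.
  assert (Cmod (z - z0) * (B + 1) < eps).
  { apply Rmult_lt_reg_r with (/ (B + 1)); [apply Rinv_0_lt_compat; lra |].
    rewrite Rmult_assoc, Rinv_r by lra. unfold Rdiv in *; lra. }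
  nra.
Qed.

Lemma has_tangent_unique (f : C -> C) (z0 l m : C) :
  has_tangent f z0 l -> has_tangent f z0 m -> l = m.
Proof.
  intros Hl Hm.
  rewrite <- (is_C_derive_unique _ _ _ (has_tangent_is_derive _ _ _ Hl)).
  apply is_C_derive_unique, has_tangent_is_derive, Hm.
Qed.

(** The factor z vanishes at the base point, so z (f z - f 0) is quadratic once f is Lipschitz at 0.
    This treats A P(c(A)) at the wall, where no derivative of [P] in [c] is at hand. *)
Lemma has_tangent_mult_lipschitz (f : C -> C) (B r : R) :
  0 < r ->
  (forall z, Cmod z < r -> Cmod (f z - f 0) <= B * Cmod z) ->
  has_tangent (fun z => z * f z)%C 0 (f 0).
Proof.
  intros Hr H. exists B, r; split; [exact Hr |]. intros z Hz.
  replace (z - 0)%C with z in * by ring.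
  replace (z * f z - 0 * f 0 - f 0 * z)%C with (z * (f z - f 0))%C by ring.
  rewrite Cmod_mult. specialize (H z Hz). pose proof (Cmod_ge_0 z). nra.
Qed.

(** * Power series have tangents *)

(** Beyond the first, each term is the difference of two consecutive partial sums, and a convergent
    sequence of partial sums is bounded. *)
Lemma is_series_bounded (b : nat -> C) (l : C) :
  is_series (K := C_AbsRing) (V := C_NormedModule) b l ->
  exists M, 0 <= M /\ forall n, Cmod (b n) <= M.
Proof.
  intros Hl.
  destruct (filterlim_bounded (K := C_AbsRing) (V := C_NormedModule)
    (sum_n b) (ex_intro _ l Hl)) as [M HM].
  assert (HM' : forall n, Cmod (sum_n (G := C_NormedModule) b n) <= M).
  { intros n. exact (HM n). }
  exists (2 * M). split.
  { pose proof (Cmod_ge_0 (sum_n (G := C_NormedModule) b 0)).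
    specialize (HM' O). lra. }
  intros [| n].
  - specialize (HM' O). rewrite sum_O in HM'.
    pose proof (Cmod_ge_0 (b O)). lra.
  - pose proof (HM' n) as H1; pose proof (HM' (S n)) as H2.
    rewrite sum_Sn in H2.
    change (Cmod (sum_n (G := C_NormedModule) b n + b (S n)) <= M) in H2.
    replace (b (S n)) with ((sum_n (G := C_NormedModule) b n + b (S n))
      + - sum_n (G := C_NormedModule) b n)%C by ring.
    eapply Rle_trans; [apply Cmod_triangle |]. rewrite Cmod_opp. lra.
Qed.

(** Convergence at the single point z0 + rho gives |a_k| rho^k <= M, a Cauchy estimate obtained
    without contour integrals. For |h| < rho/2 the ratio t = |h|/rho is at most 1/2, so the tail
    from k = 2 on is dominated by a geometric series of sum at most 2 M t^2. *)
Lemma analytic_has_tangent (f : C -> C) (z0 : C) :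
  analytic_at f z0 -> exists l, has_tangent f z0 l.
Proof.
  intros [a Ha]. destruct (locally_Cmod _ _ Ha) as [r [Hr H]]. clear Ha.
  set (rho := r / 2).
  assert (Hrho : 0 < rho) by (unfold rho; lra).
  destruct (is_series_bounded (fun k => scal (pow_n (RtoC rho) k) (a k) : C)
    (f (z0 + RtoC rho)%C)) as [M [HM0 HM]].
  { specialize (H (z0 + RtoC rho)%C).
    replace (z0 + RtoC rho - z0)%C with (RtoC rho) in H by ring.
    apply H. rewrite Cmod_R, Rabs_pos_eq; unfold rho; lra. }
  assert (Hpow : forall (z : C) k, pow_n (K := C_Ring) z k = (z ^ k)%C).
  { intros z k. induction k as [| k IH]; [reflexivity |].
    simpl. rewrite IH. reflexivity. }
  assert (Hcoef : forall k, Cmod (a k) * rho ^ k <= M).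
  { intros k. specialize (HM k).
    change (Cmod (pow_n (K := C_Ring) (RtoC rho) k * a k) <= M) in HM.
    rewrite Hpow, Cmod_mult, Cmod_pow, Cmod_R, Rabs_pos_eq in HM by lra. lra. }
  assert (Hrem : forall z, Cmod (z - z0) < rho / 2 ->
    Cmod (f z - a O - a 1%nat * (z - z0)) <= 2 * M / rho ^ 2 * Cmod (z - z0) ^ 2).
  { intros z Hz. set (h := (z - z0)%C) in *.
    set (t := Cmod h / rho).
    assert (Ht : 0 <= t <= 1 / 2).
    { unfold t. split.
      - apply Rdiv_le_0_compat; [apply Cmod_ge_0 | lra].
      - apply Rmult_le_reg_r with rho; [lra |]. unfold Rdiv at 1.
        rewrite Rmult_assoc, Rinv_l by lra. lra. }
    assert (Hterm : forall k, Cmod (h ^ k * a k) <= M * t ^ k).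
    { intros k. rewrite Cmod_mult, Cmod_pow.
      unfold t, Rdiv. rewrite Rpow_mult_distr, pow_inv.
      assert (0 < rho ^ k) by (apply pow_lt; lra).
      replace (Cmod h ^ k * Cmod (a k))
        with (Cmod (a k) * rho ^ k * (Cmod h ^ k * / rho ^ k)) by (field; lra).
      apply Rmult_le_compat_r; [| apply Hcoef].
      apply Rmult_le_pos; [apply pow_le, Cmod_ge_0 |].
      left; apply Rinv_0_lt_compat; lra. }
    set (S := sum_n (G := C_NormedModule) (fun k => (h ^ k * a k)%C)).
    (* The index [n + 1] starts the induction at the partial sum a_0 + a_1 h; the n further terms
       contribute at most M t^2 (1 + 1/2 + ... + (1/2)^(n-1)) = 2 M t^2 (1 - (1/2)^n). *)
    assert (HS : forall n, Cmod (S (n + 1)%nat - a O - a 1%nat * h)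
      <= 2 * M * t ^ 2 * (1 - (1 / 2) ^ n)).
    { induction n as [| n IH].
      - change (0 + 1)%nat with 1%nat. unfold S. rewrite sum_Sn, sum_O.
        change (Cmod ((h ^ 0 * a O + h ^ 1 * a 1%nat) - a O - a 1%nat * h)
          <= 2 * M * t ^ 2 * (1 - (1 / 2) ^ 0)).
        replace (h ^ 0 * a O + h ^ 1 * a 1%nat - a O - a 1%nat * h)%C
          with (RtoC 0) by (simpl; ring).
        rewrite Cmod_0. simpl. lra.
      - replace (Datatypes.S n + 1)%nat with (Datatypes.S (n + 1)) by lia.
        unfold S. rewrite sum_Sn. fold S.
        change (Cmod ((S (n + 1)%nat
          + h ^ (Datatypes.S (n + 1)) * a (Datatypes.S (n + 1)))
          - a O - a 1%nat * h)
          <= 2 * M * t ^ 2 * (1 - (1 / 2) ^ Datatypes.S n)).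
        replace (S (n + 1)%nat + h ^ (Datatypes.S (n + 1))
          * a (Datatypes.S (n + 1)) - a O - a 1%nat * h)%C
          with ((S (n + 1)%nat - a O - a 1%nat * h)
            + h ^ (Datatypes.S (n + 1)) * a (Datatypes.S (n + 1)))%C by ring.
        eapply Rle_trans; [apply Cmod_triangle |].
        specialize (Hterm (Datatypes.S (n + 1))).
        replace (Datatypes.S (n + 1)) with (2 + n)%nat in * by lia.
        rewrite pow_add in Hterm.
        assert (t ^ n <= (1 / 2) ^ n) by (apply pow_incr; lra).
        assert (0 <= t ^ 2) by apply pow2_ge_0.
        assert (M * (t ^ 2 * t ^ n) <= M * (t ^ 2 * (1 / 2) ^ n)).
        { apply Rmult_le_compat_l; [lra |]. apply Rmult_le_compat_l; lra. }
        simpl ((1 / 2) ^ Datatypes.S n). lra. }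
    apply le_epsilon. intros eps Heps.
    assert (Hz' : Cmod (z - z0) < r) by (fold h; unfold rho in Hz; lra).
    pose proof (H z Hz') as Hlim. fold h in Hlim.
    assert (Hlim' : filterlim S eventually
      (locally (T := C_UniformSpace) (f z))).
    { eapply filterlim_ext; [| exact Hlim]. intros n. unfold S.
      apply sum_n_ext. intros k. rewrite Hpow. reflexivity. }
    specialize (Hlim' (fun w => Cmod (w - f z) < eps)).
    destruct Hlim' as [N HN].
    { apply (proj2 (locally_C (f z) _)). exists (mkposreal _ Heps).
      intros w Hw. exact Hw. }
    specialize (HN (N + 1)%nat ltac:(lia)). specialize (HS N).
    replace (f z - a O - a 1%nat * h)%C with
      ((S (N + 1)%nat - a O - a 1%nat * h) + - (S (N + 1)%nat - f z))%C by ring.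
    eapply Rle_trans; [apply Cmod_triangle |]. rewrite Cmod_opp.
    assert (0 <= 2 * M * t ^ 2 * (1 / 2) ^ N).
    { apply Rmult_le_pos; [| apply pow_le; lra].
      apply Rmult_le_pos; [lra | apply pow2_ge_0]. }
    replace (2 * M / rho ^ 2 * Cmod h ^ 2) with (2 * M * t ^ 2)
      by (unfold t; field; lra).
    lra. }
  assert (Hf0 : f z0 = a O).
  { specialize (Hrem z0).
    replace (z0 - z0)%C with (RtoC 0) in Hrem by ring.
    rewrite Cmod_0 in Hrem.
    replace (f z0 - a O - a 1%nat * 0)%C with (f z0 - a O)%C in Hrem by ring.
    apply Ceq_minus, Cmod_eq_0. apply Rle_antisym; [| apply Cmod_ge_0].
    eapply Rle_trans; [apply Hrem; lra |]. simpl; lra. }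
  exists (a 1%nat), (2 * M / rho ^ 2), (rho / 2). split; [lra |].
  intros z Hz. rewrite Hf0. exact (Hrem z Hz).
Qed.

(** * Calculus of complex-valued curves *)

(** Continuity and derivatives of curves are taken componentwise, so that the mean value, extreme
    value and fundamental theorems for real functions apply directly. *)
Definition curve_continuous (f : R -> C) (s : R) : Prop :=
  continuous (fun x => Re (f x)) s /\ continuous (fun x => Im (f x)) s.

Definition curve_derive (f : R -> C) (s : R) (l : C) : Prop :=
  is_derive (fun x => Re (f x)) s (Re l) /\
  is_derive (fun x => Im (f x)) s (Im l).

Lemma curve_continuous_const (k : C) (s : R) : curve_continuous (fun _ => k) s.
Proof. split; apply continuous_const. Qed.

Lemma curve_continuous_minus (f g : R -> C) (s : R) :
  curve_continuous f s -> curve_continuous g s ->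
  curve_continuous (fun x => f x - g x)%C s.
Proof.
  intros [Hf1 Hf2] [Hg1 Hg2]; split.
  - apply (continuous_minus (fun x => Re (f x)) (fun x => Re (g x))); assumption.
  - apply (continuous_minus (fun x => Im (f x)) (fun x => Im (g x))); assumption.
Qed.

Lemma curve_continuous_mult (f g : R -> C) (s : R) :
  curve_continuous f s -> curve_continuous g s ->
  curve_continuous (fun x => f x * g x)%C s.
Proof.
  intros [Hf1 Hf2] [Hg1 Hg2]; split.
  - apply (continuous_minus (fun x => Re (f x) * Re (g x))
      (fun x => Im (f x) * Im (g x)));
      apply (continuous_mult (K := R_AbsRing)); assumption.
  - apply (continuous_plus (fun x => Re (f x) * Im (g x))
      (fun x => Im (f x) * Re (g x)));
      apply (continuous_mult (K := R_AbsRing)); assumption.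
Qed.

Lemma curve_continuous_sqr (f : R -> C) (s : R) :
  curve_continuous f s -> curve_continuous (fun x => f x ^ 2)%C s.
Proof.
  intros H. change (curve_continuous (fun x => f x * (f x * 1))%C s).
  apply curve_continuous_mult; [exact H |].
  apply curve_continuous_mult; [exact H | apply curve_continuous_const].
Qed.

Lemma continuous_sqr (f : R -> R) (s : R) :
  continuous f s -> continuous (fun x => f x ^ 2) s.
Proof.
  intros H. apply (continuous_ext (fun x => f x * f x)).
  - intros x. change (f x * f x = f x ^ 2). ring.
  - apply (continuous_mult (K := R_AbsRing)); assumption.
Qed.

Lemma curve_continuous_Cmod (f : R -> C) (s : R) :
  curve_continuous f s -> continuous (fun x => Cmod (f x)) s.
Proof.
  intros [H1 H2]. unfold Cmod.
  apply (continuous_comp (fun x => fst (f x) ^ 2 + snd (f x) ^ 2) sqrt).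
  - apply (continuous_plus (fun x => fst (f x) ^ 2) (fun x => snd (f x) ^ 2)).
    + apply (continuous_sqr (fun x => Re (f x))); assumption.
    + apply (continuous_sqr (fun x => Im (f x))); assumption.
  - apply continuous_sqrt.
Qed.

Lemma curve_continuous_inv (f : R -> C) (s : R) :
  f s <> 0 -> curve_continuous f s -> curve_continuous (fun x => / f x)%C s.
Proof.
  intros Hnz Hf.
  assert (Hd : fst (f s) ^ 2 + snd (f s) ^ 2 <> 0).
  { apply Cmod_gt_0 in Hnz. intros E. unfold Cmod in Hnz.
    rewrite E, sqrt_0 in Hnz. lra. }
  assert (Hinv : continuous (fun x => / (fst (f x) ^ 2 + snd (f x) ^ 2)) s).
  { destruct Hf as [H1 H2].
    apply (continuous_comp (fun x => fst (f x) ^ 2 + snd (f x) ^ 2) Rinv).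
    - apply (continuous_plus (fun x => fst (f x) ^ 2) (fun x => snd (f x) ^ 2)).
      + apply (continuous_sqr (fun x => Re (f x))); assumption.
      + apply (continuous_sqr (fun x => Im (f x))); assumption.
    - apply continuous_Rinv, Hd. }
  destruct Hf as [H1 H2]. split.
  - apply (continuous_mult (K := R_AbsRing)); [exact H1 | exact Hinv].
  - apply (continuous_mult (K := R_AbsRing)); [| exact Hinv].
    apply (continuous_opp (fun x => Im (f x))), H2.
Qed.

Lemma curve_continuous_bounded (f : R -> C) (Y : R) :
  0 <= Y -> (forall s, curve_continuous f s) ->
  exists X, 0 <= X /\ forall s, 0 <= s <= Y -> Cmod (f s) <= X.
Proof.
  intros HY Hf.
  destruct (continuity_ab_maj (fun x => Cmod (f x)) 0 Y HY) as [x [Hx _]].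
  { intros s _. apply continuity_pt_filterlim, curve_continuous_Cmod, Hf. }
  exists (Cmod (f x)). split; [apply Cmod_ge_0 | exact Hx].
Qed.

Lemma curve_continuous_bounded_below (f : R -> C) (Y : R) :
  0 <= Y -> (forall s, curve_continuous f s) ->
  (forall s, 0 <= s <= Y -> f s <> 0) ->
  exists m, 0 < m /\ forall s, 0 <= s <= Y -> m <= Cmod (f s).
Proof.
  intros HY Hf Hnz.
  destruct (continuity_ab_min (fun x => Cmod (f x)) 0 Y HY) as [x [Hx Hx']].
  { intros s _. apply continuity_pt_filterlim, curve_continuous_Cmod, Hf. }
  exists (Cmod (f x)). split; [apply Cmod_gt_0, Hnz, Hx' | exact Hx].
Qed.

Lemma curve_derive_minus (f g : R -> C) (s : R) (l m : C) :
  curve_derive f s l -> curve_derive g s m ->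
  curve_derive (fun x => f x - g x)%C s (l - m)%C.
Proof.
  intros [Hf1 Hf2] [Hg1 Hg2]; split.
  - apply (is_derive_minus (fun x => Re (f x)) (fun x => Re (g x))); assumption.
  - apply (is_derive_minus (fun x => Im (f x)) (fun x => Im (g x))); assumption.
Qed.

Lemma curve_derive_mult (f g : R -> C) (s : R) (l m : C) :
  curve_derive f s l -> curve_derive g s m ->
  curve_derive (fun x => f x * g x)%C s (l * g s + f s * m)%C.
Proof.
  intros [Hf1 Hf2] [Hg1 Hg2]; split.
  - replace (Re (l * g s + f s * m)) with
      ((Re l * Re (g s) + Re (f s) * Re m)
        - (Im l * Im (g s) + Im (f s) * Im m))
      by (unfold Re, Im; simpl; ring).
    apply (is_derive_minus (fun x => Re (f x) * Re (g x))
      (fun x => Im (f x) * Im (g x)));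
      apply (is_derive_mult (K := R_AbsRing)); auto; exact Rmult_comm.
  - replace (Im (l * g s + f s * m)) with
      ((Re l * Im (g s) + Re (f s) * Im m)
        + (Im l * Re (g s) + Im (f s) * Re m))
      by (unfold Re, Im; simpl; ring).
    apply (is_derive_plus (fun x => Re (f x) * Im (g x))
      (fun x => Im (f x) * Re (g x)));
      apply (is_derive_mult (K := R_AbsRing)); auto; exact Rmult_comm.
Qed.

Lemma curve_derive_const (k : C) (s : R) : curve_derive (fun _ => k) s 0.
Proof. split; apply (is_derive_const (K := R_AbsRing) (V := R_NormedModule)). Qed.

(** Turns the sensitivity integral into an endpoint difference of a primitive, so that the Wronskian
    can be compared with it through a mean value bound on derivatives. *)
Lemma curve_antiderivative (g : R -> C) (Y : R) :
  (forall s, curve_continuous g s) ->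
  exists G, (forall s, curve_continuous G s /\ curve_derive G s (g s)) /\
    (G Y - G 0 = RInt (V := C_R_CompleteNormedModule) g 0 Y)%C.
Proof.
  intros Hg.
  assert (Hex : forall (f : R -> R) a b, (forall x, continuous f x) ->
    is_RInt f a b (RInt f a b)).
  { intros f a b Hf. apply (RInt_correct (V := R_CompleteNormedModule)).
    apply (ex_RInt_continuous (V := R_CompleteNormedModule)). auto. }
  assert (Hder : forall f : R -> R, (forall x, continuous f x) ->
    forall s, is_derive (fun x => RInt f 0 x) s (f s)).
  { intros f Hf s. apply (is_derive_RInt f _ 0).
    - apply filter_forall. intros x. apply Hex, Hf.
    - apply Hf. }
  assert (HRe : forall x, continuous (fun x => Re (g x)) x) by apply Hg.
  assert (HIm : forall x, continuous (fun x => Im (g x)) x) by apply Hg.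
  exists (fun s => (RInt (fun x => Re (g x)) 0 s, RInt (fun x => Im (g x)) 0 s)).
  split.
  - intros s.
    assert (D : curve_derive (fun s =>
      (RInt (fun x => Re (g x)) 0 s, RInt (fun x => Im (g x)) 0 s)) s (g s)).
    { split; [apply (Hder (fun x => Re (g x)) HRe)
             | apply (Hder (fun x => Im (g x)) HIm)]. }
    split; [| exact D].
    split; apply (ex_derive_continuous (K := R_AbsRing) (V := R_NormedModule));
      [exists (Re (g s)) | exists (Im (g s))]; apply D.
  - assert (E : is_RInt (V := C_R_CompleteNormedModule) g 0 Y
      (RInt (fun x => Re (g x)) 0 Y, RInt (fun x => Im (g x)) 0 Y)).
    { apply (is_RInt_fct_extend_pair (U := R_NormedModule) (V := R_NormedModule) g);
        apply Hex; assumption. }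
    rewrite (is_RInt_unique (V := C_R_CompleteNormedModule) _ _ _ _ E).
    rewrite !RInt_point. apply injective_projections; simpl; unfold zero; simpl; ring.
Qed.

(** * Growth estimates *)

Lemma is_derive_le (F dF : R -> R) (a b : R) :
  a <= b -> (forall s, continuous F s) ->
  (forall s, a < s < b -> is_derive F s (dF s)) ->
  (forall s, a <= s <= b -> 0 <= dF s) -> F a <= F b.
Proof.
  intros Hab Hc Hd Hp.
  destruct (MVT_gen F a b dF) as [c [Hcab E]].
  - rewrite Rmin_left, Rmax_right by lra. exact Hd.
  - intros. apply continuity_pt_filterlim, Hc.
  - rewrite Rmin_left, Rmax_right in Hcab by lra.
    specialize (Hp c Hcab). nra.
Qed.

(** From |F'| <= L F, the product F e^(Ls) is nondecreasing and F e^(-Ls) is nonincreasing. Both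
    directions matter: continuous dependence is propagated backwards from [y_b], where the solutions
    are normalised, while uniqueness is used forwards from the wall. *)
Lemma gronwall (F dF : R -> R) (L Y : R) :
  (forall s, continuous F s) ->
  (forall s, 0 < s < Y -> is_derive F s (dF s)) ->
  (forall s, 0 <= s <= Y -> Rabs (dF s) <= L * F s) ->
  forall a b, 0 <= a <= b -> b <= Y ->
    F a <= F b * exp (L * (b - a)) /\ F b <= F a * exp (L * (b - a)).
Proof.
  intros Hc Hd HL a b Hab HbY.
  assert (Hce : forall K s, continuous (fun x => exp (K * x)) s).
  { intros K s. apply (ex_derive_continuous (K := R_AbsRing) (V := R_NormedModule)).
    auto_derive. exact I. }
  assert (Hde : forall K s, 0 < s < Y -> is_derive (fun x => F x * exp (K * x)) s
     ((dF s + K * F s) * exp (K * s))).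
  { intros K s Hs.
    replace ((dF s + K * F s) * exp (K * s)) with
      (dF s * exp (K * s) + F s * (K * exp (K * s))) by ring.
    apply (is_derive_mult (K := R_AbsRing) F (fun x => exp (K * x)));
      [apply Hd, Hs | | exact Rmult_comm].
    auto_derive; [exact I | ring]. }
  assert (HcF : forall K s, continuous (fun x => F x * exp (K * x)) s).
  { intros K s. apply (continuous_mult (K := R_AbsRing)); auto. }
  assert (Hsplit : forall x y, exp (L * (x - y)) = exp (L * x) * exp (- L * y)).
  { intros x y. rewrite <- exp_plus. f_equal; ring. }
  assert (Hone : forall x, exp (L * x) * exp (- L * x) = 1).
  { intros x. rewrite <- Hsplit, Rminus_diag_eq, Rmult_0_r by reflexivity.
    apply exp_0. }
  rewrite Hsplit. split.
  - assert (Hmono : F a * exp (L * a) <= F b * exp (L * b)).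
    { apply (is_derive_le (fun x => F x * exp (L * x))
        (fun s => (dF s + L * F s) * exp (L * s))); [lra | auto | |].
      - intros s Hs; apply Hde; lra.
      - intros s Hs. apply Rmult_le_pos; [| left; apply exp_pos].
        assert (HsY : 0 <= s <= Y) by lra. specialize (HL s HsY).
        apply Rabs_le_between in HL. lra. }
    replace (F a) with (F a * exp (L * a) * exp (- L * a))
      by (rewrite Rmult_assoc, Hone; ring).
    rewrite <- Rmult_assoc.
    apply Rmult_le_compat_r; [left; apply exp_pos | exact Hmono].
  - assert (Hmono : - (F a * exp (- L * a)) <= - (F b * exp (- L * b))).
    { apply (is_derive_le (fun x => - (F x * exp (- L * x)))
        (fun s => - ((dF s + - L * F s) * exp (- L * s)))); [lra | | |].
      - intros s. apply (continuous_opp (fun x => F x * exp (- L * x))), HcF.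
      - intros s Hs. apply (is_derive_opp (fun x => F x * exp (- L * x))).
        apply Hde; lra.
      - intros s Hs. assert (HsY : 0 <= s <= Y) by lra. specialize (HL s HsY).
        apply Rabs_le_between in HL. pose proof (exp_pos (- L * s)). nra. }
    replace (F b) with (F b * exp (- L * b) * exp (L * b)).
    2:{ rewrite Rmult_assoc, (Rmult_comm (exp (- L * b))), Hone. ring. }
    rewrite (Rmult_comm (exp (L * b))), <- Rmult_assoc.
    apply Rmult_le_compat_r; [left; apply exp_pos | lra].
Qed.

(** The intermediate points for the real and imaginary parts differ, so the two bounds are added;
    hence the factor 2. *)
Lemma curve_mean_value (f df : R -> C) (Y K : R) :
  0 <= Y -> (forall s, curve_continuous f s) ->
  (forall s, 0 < s < Y -> curve_derive f s (df s)) ->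
  (forall s, 0 <= s <= Y -> Cmod (df s) <= K) ->
  Cmod (f Y - f 0) <= 2 * K * Y.
Proof.
  intros HY Hc Hd HK.
  assert (Hreal : forall g dg : R -> R, (forall s, continuous g s) ->
    (forall s, 0 < s < Y -> is_derive g s (dg s)) ->
    (forall s, 0 <= s <= Y -> Rabs (dg s) <= K) -> Rabs (g Y - g 0) <= K * Y).
  { intros g dg Hgc Hgd HgK.
    destruct (MVT_gen g 0 Y dg) as [c [Hc0 E]].
    - rewrite Rmin_left, Rmax_right by lra. exact Hgd.
    - intros. apply continuity_pt_filterlim, Hgc.
    - rewrite Rmin_left, Rmax_right in Hc0 by lra.
      rewrite E, Rabs_mult, (Rabs_pos_eq (Y - 0)) by lra.
      specialize (HgK c Hc0). rewrite Rminus_0_r.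
      apply Rmult_le_compat_r; lra. }
  assert (H1 : Rabs (Re (f Y) - Re (f 0)) <= K * Y).
  { apply (Hreal (fun x => Re (f x)) (fun x => Re (df x))).
    - intros; apply Hc.
    - intros; apply Hd; assumption.
    - intros s Hs. eapply Rle_trans; [apply re_le_Cmod | apply HK, Hs]. }
  assert (H2 : Rabs (Im (f Y) - Im (f 0)) <= K * Y).
  { apply (Hreal (fun x => Im (f x)) (fun x => Im (df x))).
    - intros; apply Hc.
    - intros; apply Hd; assumption.
    - intros s Hs. eapply Rle_trans; [| apply HK, Hs].
      eapply Rle_trans; [| apply Rmax_Cmod]. apply Rmax_r. }
  replace (f Y - f 0)%C with
    (RtoC (Re (f Y) - Re (f 0)) + Ci * RtoC (Im (f Y) - Im (f 0)))%C.
  2:{ apply injective_projections; unfold Re, Im; simpl; ring. }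
  eapply Rle_trans; [apply Cmod_triangle |].
  rewrite Cmod_mult, Cmod_Ci, !Cmod_R. lra.
Qed.

Lemma dot_le_Cmod (z w : C) :
  Rabs (Re z * Re w + Im z * Im w) <= Cmod z * Cmod w.
Proof.
  replace (Re z * Re w + Im z * Im w) with (Re (Cconj z * w)%C)
    by (unfold Re, Im; simpl; ring).
  eapply Rle_trans; [apply re_le_Cmod |].
  rewrite Cmod_mult, Cmod_conj. lra.
Qed.

(** The energy |p|^2 + |q|^2 + d^2 contains the constant d, so a forcing of size L d is absorbed and
    a homogeneous Gronwall inequality suffices. The rate 3L comes from 2x(y + d) + 2y(x + d) <=
    3(x^2 + y^2 + d^2). *)
Lemma linear_system_growth (p q f g : R -> C) (L d Y : R) :
  0 <= L -> 0 <= d ->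
  (forall s, curve_continuous p s /\ curve_continuous q s) ->
  (forall s, 0 < s < Y -> curve_derive p s (f s) /\ curve_derive q s (g s)) ->
  (forall s, 0 <= s <= Y -> Cmod (f s) <= L * (Cmod (q s) + d) /\
    Cmod (g s) <= L * (Cmod (p s) + d)) ->
  forall a b, 0 <= a <= b -> b <= Y ->
    Cmod (p a) ^ 2 + Cmod (q a) ^ 2 + d ^ 2 <=
      (Cmod (p b) ^ 2 + Cmod (q b) ^ 2 + d ^ 2) * exp (3 * L * (b - a)) /\
    Cmod (p b) ^ 2 + Cmod (q b) ^ 2 + d ^ 2 <=
      (Cmod (p a) ^ 2 + Cmod (q a) ^ 2 + d ^ 2) * exp (3 * L * (b - a)).
Proof.
  intros HL Hd0 Hc Hd HB.
  set (F := fun s => Re (p s) * Re (p s) + Im (p s) * Im (p s)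
    + (Re (q s) * Re (q s) + Im (q s) * Im (q s)) + d ^ 2).
  set (dF := fun s => 2 * (Re (p s) * Re (f s) + Im (p s) * Im (f s))
    + 2 * (Re (q s) * Re (g s) + Im (q s) * Im (g s))).
  assert (HF : forall s, Cmod (p s) ^ 2 + Cmod (q s) ^ 2 + d ^ 2 = F s).
  { intros s. unfold F. rewrite !Cmod2_alt. ring. }
  intros a b Hab HbY. rewrite !HF.
  apply (gronwall F dF (3 * L) Y); try assumption.
  - intros s. destruct (Hc s) as [[Hp1 Hp2] [Hq1 Hq2]]. unfold F.
    apply (continuous_plus (V := R_NormedModule)); [| apply continuous_const].
    apply (continuous_plus (V := R_NormedModule));
      apply (continuous_plus (V := R_NormedModule));
      apply (continuous_mult (K := R_AbsRing)); assumption.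
  - intros s Hs. destruct (Hd s Hs) as [[Hp1 Hp2] [Hq1 Hq2]]. unfold F, dF.
    evar_last.
    + apply (is_derive_plus (V := R_NormedModule));
        [| apply (is_derive_const (K := R_AbsRing) (V := R_NormedModule))].
      apply (is_derive_plus (V := R_NormedModule));
        apply (is_derive_plus (V := R_NormedModule));
        (apply (is_derive_mult (K := R_AbsRing));
         [eassumption | eassumption | exact Rmult_comm]).
    + unfold plus, mult, zero; simpl. ring.
  - intros s Hs. destruct (HB s Hs) as [Hf Hg]. rewrite <- HF. unfold dF.
    pose proof (dot_le_Cmod (p s) (f s)) as H1.
    pose proof (dot_le_Cmod (q s) (g s)) as H2.
    pose proof (Cmod_ge_0 (p s)) as Hp0. pose proof (Cmod_ge_0 (q s)) as Hq0.
    eapply Rle_trans; [apply Rabs_triang |].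
    rewrite (Rabs_mult 2), (Rabs_mult 2 (Re (q s) * Re (g s) + _)),
      (Rabs_pos_eq 2) by lra.
    assert (H3 : Cmod (p s) * Cmod (f s) <= Cmod (p s) * (L * (Cmod (q s) + d)))
      by (apply Rmult_le_compat_l; assumption).
    assert (H4 : Cmod (q s) * Cmod (g s) <= Cmod (q s) * (L * (Cmod (p s) + d)))
      by (apply Rmult_le_compat_l; assumption).
    set (x := Cmod (p s)) in *. set (y := Cmod (q s)) in *.
    assert (H5 : 2 * (x * (y + d)) + 2 * (y * (x + d)) <= 3 * (x ^ 2 + y ^ 2 + d ^ 2)).
    { pose proof (pow2_ge_0 (x - y)). pose proof (pow2_ge_0 (x - d)).
      pose proof (pow2_ge_0 (y - d)). pose proof (pow2_ge_0 d). nra. }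
    assert (H6 : L * (2 * (x * (y + d)) + 2 * (y * (x + d)))
      <= L * (3 * (x ^ 2 + y ^ 2 + d ^ 2))) by (apply Rmult_le_compat_l; lra).
    lra.
Qed.

(** * Linear systems depending on a parameter *)

(** The equations are asked only in the open interval, because functions extended by constants
    beyond [0, Y] may have corners at the end points. *)
Definition system_solution (Y : R) (a b p q : R -> C) : Prop :=
  (forall s, curve_continuous p s /\ curve_continuous q s) /\
  (forall s, 0 < s < Y ->
    curve_derive p s (a s * q s)%C /\ curve_derive q s (b s * p s)%C).

(** Growth with d = 0 and zero initial energy. It will show that the eigenfunction cannot vanish at
    the rigid wall. *)
Lemma system_solution_zero (Y X : R) (a b p q : R -> C) :
  0 <= Y -> 0 <= X ->
  (forall s, 0 <= s <= Y -> Cmod (a s) <= X /\ Cmod (b s) <= X) ->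
  system_solution Y a b p q -> p 0 = 0 -> q 0 = 0 -> p Y = 0.
Proof.
  intros HY HX HB [Hc Hd] Hp Hq.
  destruct (linear_system_growth p q (fun s => a s * q s)%C
    (fun s => b s * p s)%C X 0 Y HX (Rle_refl 0) Hc Hd) with (a := 0) (b := Y)
    as [_ H]; try lra.
  { intros s Hs. rewrite !Cmod_mult, !Rplus_0_r.
    destruct (HB s Hs). pose proof (Cmod_ge_0 (p s)); pose proof (Cmod_ge_0 (q s)).
    split; apply Rmult_le_compat_r; assumption. }
  rewrite Hp, Hq, Cmod_0 in H.
  apply Cmod_eq_0. pose proof (Cmod_ge_0 (p Y)). pose proof (pow2_ge_0 (Cmod (q Y))).
  assert (Cmod (p Y) ^ 2 <= 0) by lra. nra.
Qed.

(** The differences of the solutions for c and c0 satisfy (p_c - p_0)' = a_c (q_c - q_0) + (a_c -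
    a_0) q_0 and its mirror image, so the forcing is O(|c - c0|) and [linear_system_growth] applies
    with d = |c - c0|. The energy at Y is O(d^2), since p is pinned to k there and q has a
    tangent. *)
Lemma system_lipschitz (Y X : R) (a b p q : C -> R -> C) (c0 k m : C) (r : R) :
  0 <= Y -> 0 <= X -> 0 < r ->
  (forall c s, Cmod (c - c0) < r -> 0 <= s <= Y ->
    Cmod (a c s) <= X /\ Cmod (b c s) <= X /\
    Cmod (a c s - a c0 s) <= X * Cmod (c - c0) /\
    Cmod (b c s - b c0 s) <= X * Cmod (c - c0)) ->
  (forall c, Cmod (c - c0) < r -> system_solution Y (a c) (b c) (p c) (q c)) ->
  (forall c, Cmod (c - c0) < r -> p c Y = k) ->
  has_tangent (fun c => q c Y) c0 m ->
  exists B r', 0 <= B /\ 0 < r' <= r /\ forall c s, Cmod (c - c0) < r' ->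
    0 <= s <= Y ->
    Cmod (p c s - p c0 s) <= B * Cmod (c - c0) /\
    Cmod (q c s - q c0 s) <= B * Cmod (c - c0).
Proof.
  intros HY HX Hr Hab Hsol Hp Hq.
  destruct (has_tangent_bounds _ _ _ r Hq Hr) as [Bq [r' [HBq [Hr' Hqt]]]].
  assert (H0 : Cmod (c0 - c0) < r).
  { replace (c0 - c0)%C with (RtoC 0) by ring. rewrite Cmod_0. lra. }
  destruct (Hsol c0 H0) as [Hc0 Hd0].
  destruct (curve_continuous_bounded (p c0) Y HY (fun s => proj1 (Hc0 s)))
    as [Xp [HXp HXp']].
  destruct (curve_continuous_bounded (q c0) Y HY (fun s => proj2 (Hc0 s)))
    as [Xq [HXq HXq']].
  set (L := X * (1 + Xp + Xq)).
  assert (HXL : X <= L /\ X * Xp <= L /\ X * Xq <= L) by (unfold L; nra).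
  (* The last [+ 1] makes B >= 1; the energy bound (B - 1) d^2 is then below (B d)^2, and no square
     root of the exponential is needed. *)
  set (B := (Bq ^ 2 + 1) * exp (3 * L * Y) + 1).
  assert (HBq2 : 0 <= Bq ^ 2) by apply pow2_ge_0.
  assert (HB : 1 <= B).
  { unfold B. pose proof (exp_pos (3 * L * Y)). nra. }
  exists B, r'. split; [lra |]. split; [exact Hr' |].
  intros c s Hc Hs.
  assert (Hcr : Cmod (c - c0) < r) by lra.
  destruct (Hsol c Hcr) as [Hcc Hdc].
  set (d := Cmod (c - c0)) in *.
  assert (Hd : 0 <= d) by apply Cmod_ge_0.
  destruct (linear_system_growth (fun s => p c s - p c0 s)%C
    (fun s => q c s - q c0 s)%C
    (fun s => a c s * q c s - a c0 s * q c0 s)%C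
    (fun s => b c s * p c s - b c0 s * p c0 s)%C L d Y) with (a := s) (b := Y)
    as [H _]; try lra.
  - intros x. destruct (Hc0 x), (Hcc x).
    split; apply curve_continuous_minus; assumption.
  - intros x Hx. destruct (Hd0 x Hx), (Hdc x Hx).
    split; apply curve_derive_minus; assumption.
  - intros x Hx.
    assert (Hlin : forall u u0 v v0 : C, forall K, 0 <= K ->
      Cmod u <= X -> Cmod (u - u0) <= X * d -> Cmod v0 <= K -> X * K <= L ->
      Cmod (u * v - u0 * v0) <= L * (Cmod (v - v0) + d)).
    { intros u u0 v v0 K HK H1 H2 H3 H4.
      replace (u * v - u0 * v0)%C with (u * (v - v0) + (u - u0) * v0)%C by ring.
      eapply Rle_trans; [apply Cmod_triangle |]. rewrite !Cmod_mult.
      pose proof (Cmod_ge_0 (v - v0)).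
      assert (Cmod u * Cmod (v - v0) <= L * Cmod (v - v0))
        by (apply Rmult_le_compat_r; lra).
      assert (Cmod (u - u0) * Cmod v0 <= (X * d) * K)
        by (apply Rmult_le_compat; auto using Cmod_ge_0).
      assert (d * (X * K) <= d * L) by (apply Rmult_le_compat_l; lra). lra. }
    destruct (Hab c x Hcr Hx) as [H1 [H2 [H3 H4]]].
    split; [apply (Hlin _ _ _ _ Xq) | apply (Hlin _ _ _ _ Xp)];
      auto; lra.
  - destruct (Hqt c Hc) as [_ HqY]. cbv beta in H.
    rewrite (Hp c Hcr), (Hp c0 H0) in H.
    replace (k - k)%C with (RtoC 0) in H by ring. rewrite Cmod_0 in H.
    assert (HE : Cmod (p c s - p c0 s) ^ 2 + Cmod (q c s - q c0 s) ^ 2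
      <= (B * d) ^ 2).
    { assert (Hq2 : Cmod (q c Y - q c0 Y) ^ 2 <= (Bq * d) ^ 2)
        by (apply pow_incr; split; [apply Cmod_ge_0 | exact HqY]).
      assert (Hexp : exp (3 * L * (Y - s)) <= exp (3 * L * Y)).
      { assert (0 <= L) by (unfold L; nra).
        assert (Hle : 3 * L * (Y - s) <= 3 * L * Y) by nra.
        destruct Hle as [Hlt | Heq];
          [left; apply exp_increasing, Hlt | rewrite Heq; lra]. }
      assert (Hd2 : 0 <= d ^ 2) by apply pow2_ge_0.
      assert ((0 ^ 2 + Cmod (q c Y - q c0 Y) ^ 2 + d ^ 2) * exp (3 * L * (Y - s))
        <= ((Bq ^ 2 + 1) * d ^ 2) * exp (3 * L * Y)).
      { apply Rmult_le_compat.
        - pose proof (pow2_ge_0 (Cmod (q c Y - q c0 Y))). lra.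
        - left; apply exp_pos.
        - rewrite Rpow_mult_distr in Hq2. lra.
        - exact Hexp. }
      assert ((B - 1) * d ^ 2 <= B ^ 2 * d ^ 2)
        by (apply Rmult_le_compat_r; nra).
      rewrite Rpow_mult_distr. unfold B in *. lra. }
    assert (HBd : 0 <= B * d) by nra.
    split; apply Rsqr_incr_0_var; try exact HBd; unfold Rsqr.
    + pose proof (pow2_ge_0 (Cmod (q c s - q c0 s))). lra.
    + pose proof (pow2_ge_0 (Cmod (p c s - p c0 s))). lra.
Qed.

(** In (b_c - b_0) p_c p_0, replacing b_c - b_0 by b_1 h costs a quadratic error, and replacing p_c
    by p_0 costs |h| times a Lipschitz increment, again quadratic; likewise for a and q. Since p is
    fixed at Y, the Wronskian there is (q_c - q_0) k, whence the term m k. *)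
Lemma system_sensitivity (Y X : R) (a b p q : C -> R -> C) (a1 b1 : R -> C)
    (c0 k m : C) (r : R) :
  0 <= Y -> 0 <= X -> 0 < r <= 1 ->
  (forall s, curve_continuous a1 s /\ curve_continuous b1 s) ->
  (forall c s, Cmod (c - c0) < r -> 0 <= s <= Y ->
    Cmod (a c0 s) <= X /\ Cmod (b c0 s) <= X /\
    Cmod (a c s - a c0 s - a1 s * (c - c0)) <= X * Cmod (c - c0) ^ 2 /\
    Cmod (b c s - b c0 s - b1 s * (c - c0)) <= X * Cmod (c - c0) ^ 2) ->
  (forall c, Cmod (c - c0) < r -> system_solution Y (a c) (b c) (p c) (q c)) ->
  (forall c, Cmod (c - c0) < r -> p c Y = k) ->
  has_tangent (fun c => q c Y) c0 m ->
  (exists B r', 0 < r' /\ forall c, Cmod (c - c0) < r' ->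
    Cmod (p c 0 - p c0 0) <= B * Cmod (c - c0)) /\
  has_tangent (fun c => q c 0 * p c0 0 - q c0 0 * p c 0)%C c0
    (m * k - RInt (V := C_R_CompleteNormedModule)
       (fun s => b1 s * p c0 s ^ 2 - a1 s * q c0 s ^ 2)%C 0 Y)%C.
Proof.
  intros HY HX Hr Hcab Hab Hsol Hp Hq.
  destruct (curve_continuous_bounded a1 Y HY (fun s => proj1 (Hcab s)))
    as [Xa [HXa HXa']].
  destruct (curve_continuous_bounded b1 Y HY (fun s => proj2 (Hcab s)))
    as [Xb [HXb HXb']].
  assert (H0 : Cmod (c0 - c0) < r).
  { replace (c0 - c0)%C with (RtoC 0) by ring. rewrite Cmod_0. lra. }
  assert (Hlin : forall c (u u0 u1 : C) K, Cmod (c - c0) < r -> 0 <= K ->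
    Cmod u1 <= K -> Cmod (u - u0 - u1 * (c - c0)) <= X * Cmod (c - c0) ^ 2 ->
    Cmod (u - u0) <= (X + K) * Cmod (c - c0)).
  { intros c u u0 u1 K Hc HK Hu1 Hu.
    replace (u - u0)%C with ((u - u0 - u1 * (c - c0)) + u1 * (c - c0))%C by ring.
    eapply Rle_trans; [apply Cmod_triangle |]. rewrite Cmod_mult.
    pose proof (Cmod_ge_0 (c - c0)).
    assert (Cmod (c - c0) ^ 2 <= Cmod (c - c0)) by nra.
    assert (X * Cmod (c - c0) ^ 2 <= X * Cmod (c - c0))
      by (apply Rmult_le_compat_l; lra).
    assert (Cmod u1 * Cmod (c - c0) <= K * Cmod (c - c0))
      by (apply Rmult_le_compat_r; lra).
    lra. }
  assert (Hbnd : forall c (u u0 : C) K, Cmod (c - c0) < r -> 0 <= K ->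
    Cmod u0 <= X -> Cmod (u - u0) <= (X + K) * Cmod (c - c0) ->
    Cmod u <= 2 * X + K).
  { intros c u u0 K Hc HK Hu0 Hu.
    replace u with (u0 + (u - u0))%C by ring.
    eapply Rle_trans; [apply Cmod_triangle |].
    pose proof (Cmod_ge_0 (c - c0)).
    assert ((X + K) * Cmod (c - c0) <= (X + K) * 1)
      by (apply Rmult_le_compat_l; lra).
    lra. }
  set (X' := 2 * X + Xa + Xb).
  destruct (system_lipschitz Y X' a b p q c0 k m r) as [B [r' [HB [Hr' HL]]]];
    try assumption; try (unfold X'; lra).
  { intros c s Hc Hs. destruct (Hab c s Hc Hs) as [H1 [H2 [H3 H4]]].
    pose proof (Hlin c _ _ _ Xa Hc HXa (HXa' s Hs) H3) as H5.
    pose proof (Hlin c _ _ _ Xb Hc HXb (HXb' s Hs) H4) as H6.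
    pose proof (Hbnd c _ _ Xa Hc HXa H1 H5).
    pose proof (Hbnd c _ _ Xb Hc HXb H2 H6).
    pose proof (Cmod_ge_0 (c - c0)).
    unfold X'. repeat split; try lra.
    - eapply Rle_trans; [exact H5 |]. apply Rmult_le_compat_r; lra.
    - eapply Rle_trans; [exact H6 |]. apply Rmult_le_compat_r; lra. }
  split.
  { exists B, r'. split; [lra |]. intros c Hc. apply (HL c 0 Hc); lra. }
  destruct (Hsol c0 H0) as [Hc0 Hd0].
  destruct (curve_continuous_bounded (p c0) Y HY (fun s => proj1 (Hc0 s)))
    as [Xp [HXp HXp']].
  destruct (curve_continuous_bounded (q c0) Y HY (fun s => proj2 (Hc0 s)))
    as [Xq [HXq HXq']].
  set (g := fun s => (b1 s * p c0 s ^ 2 - a1 s * q c0 s ^ 2)%C).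
  destruct (curve_antiderivative g Y) as [G [HG HGY]].
  { intros s. destruct (Hc0 s), (Hcab s). unfold g.
    apply curve_continuous_minus; apply curve_continuous_mult;
      try assumption; apply curve_continuous_sqr; assumption. }
  fold g. rewrite <- HGY.
  destruct Hq as [Bq [rq [Hrq Hq]]].
  (* [Z] times |h|^2 bounds the derivative of the Wronskian minus h G. In each pair, the first
     summand is the remainder of a coefficient times two solution bounds (|p_c| <= Xp + B), the
     second a first-order coefficient times a Lipschitz increment. *)
  set (Z := X * ((Xp + B) * Xp) + Xb * (B * Xp)
    + (X * ((Xq + B) * Xq) + Xa * (B * Xq))).
  exists (2 * Z * Y + Bq * Cmod k), (Rmin r' rq). split; [apply Rmin_pos; lra |].
  intros c Hc. pose proof (Rmin_l r' rq); pose proof (Rmin_r r' rq).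
  assert (Hcr : Cmod (c - c0) < r) by lra.
  assert (Hcr' : Cmod (c - c0) < r') by lra.
  assert (Hcq : Cmod (c - c0) < rq) by lra.
  specialize (Hq c Hcq).
  destruct (Hsol c Hcr) as [Hcc Hdc].
  set (h := (c - c0)%C) in *.
  (* Subtracting h G cancels the first-order part of the derivative of the Wronskian; what remains
     is O(|h|^2) uniformly on [0, Y]. *)
  pose proof (curve_mean_value
    (fun s => q c s * p c0 s - q c0 s * p c s - h * G s)%C
    (fun s => (b c s * p c s) * p c0 s + q c s * (a c0 s * q c0 s)
      - ((b c0 s * p c0 s) * p c s + q c0 s * (a c s * q c s))
      - (0 * G s + h * g s))%C Y (Z * Cmod h ^ 2) HY) as HV.
  assert (HV' : Cmod ((q c Y * p c0 Y - q c0 Y * p c Y - h * G Y)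
    - (q c 0 * p c0 0 - q c0 0 * p c 0 - h * G 0)) <= 2 * (Z * Cmod h ^ 2) * Y).
  { apply HV; clear HV.
    - intros s. destruct (Hc0 s), (Hcc s), (HG s).
      apply curve_continuous_minus; [apply curve_continuous_minus |];
        apply curve_continuous_mult; try assumption.
      apply curve_continuous_const.
    - intros s Hs. destruct (Hd0 s Hs), (Hdc s Hs), (HG s).
      apply curve_derive_minus; [apply curve_derive_minus |];
        apply curve_derive_mult; try assumption. apply curve_derive_const.
    - intros s Hs. destruct (Hab c s Hcr Hs) as [_ [_ [H3 H4]]].
      destruct (HL c s Hcr' Hs) as [H5 H6]. fold h in H3, H4, H5, H6.
      specialize (HXp' s Hs); specialize (HXq' s Hs).
      specialize (HXa' s Hs); specialize (HXb' s Hs).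
      pose proof (Cmod_ge_0 h) as Hh.
      unfold g.
      replace (b c s * p c s * p c0 s + q c s * (a c0 s * q c0 s)
        - (b c0 s * p c0 s * p c s + q c0 s * (a c s * q c s))
        - (0 * G s + h * (b1 s * p c0 s ^ 2 - a1 s * q c0 s ^ 2)))%C with
        (((b c s - b c0 s - b1 s * h) * (p c s * p c0 s)
          + b1 s * (h * (p c s - p c0 s) * p c0 s))
         + - ((a c s - a c0 s - a1 s * h) * (q c s * q c0 s)
          + a1 s * (h * (q c s - q c0 s) * q c0 s)))%C by ring.
      assert (Hpiece : forall (e u1 v v0 : C) K Kv, 0 <= K -> 0 <= Kv ->
        Cmod e <= X * Cmod h ^ 2 -> Cmod u1 <= K -> Cmod v0 <= Kv ->
        Cmod (v - v0) <= B * Cmod h ->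
        Cmod (e * (v * v0) + u1 * (h * (v - v0) * v0))
        <= (X * ((Kv + B) * Kv) + K * (B * Kv)) * Cmod h ^ 2).
      { intros e u1 v v0 K Kv HK HKv He Hu1 Hv0 Hv.
        assert (Hvb : Cmod v <= Kv + B).
        { replace v with (v0 + (v - v0))%C by ring.
          eapply Rle_trans; [apply Cmod_triangle |].
          assert (B * Cmod h <= B * 1) by (apply Rmult_le_compat_l; lra). lra. }
        eapply Rle_trans; [apply Cmod_triangle |]. rewrite !Cmod_mult.
        assert (E1 : Cmod e * (Cmod v * Cmod v0)
          <= (X * Cmod h ^ 2) * ((Kv + B) * Kv)).
        { apply Rmult_le_compat; try (apply Cmod_ge_0); try assumption.
          - apply Rmult_le_pos; apply Cmod_ge_0.
          - apply Rmult_le_compat; auto using Cmod_ge_0. }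
        assert (E2 : Cmod u1 * (Cmod h * Cmod (v - v0) * Cmod v0)
          <= K * (Cmod h * (B * Cmod h) * Kv)).
        { apply Rmult_le_compat; try (apply Cmod_ge_0); try assumption.
          - repeat apply Rmult_le_pos; apply Cmod_ge_0.
          - apply Rmult_le_compat; try (apply Cmod_ge_0); try assumption.
            + repeat apply Rmult_le_pos; apply Cmod_ge_0.
            + apply Rmult_le_compat_l; assumption. }
        lra. }
      eapply Rle_trans; [apply Cmod_triangle |]. rewrite Cmod_opp.
      pose proof (Hpiece _ (b1 s) (p c s) (p c0 s) Xb Xp HXb HXp H4 HXb' HXp' H5).
      pose proof (Hpiece _ (a1 s) (q c s) (q c0 s) Xa Xq HXa HXq H3 HXa' HXq' H6).
      unfold Z. lra. }
  rewrite (Hp c Hcr), (Hp c0 H0) in HV'.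
  replace (q c 0 * p c0 0 - q c0 0 * p c 0
    - (q c0 0 * p c0 0 - q c0 0 * p c0 0) - (m * k - (G Y - G 0)) * h)%C with
    (- ((q c Y * k - q c0 Y * k - h * G Y)
       - (q c 0 * p c0 0 - q c0 0 * p c 0 - h * G 0))
     + (q c Y - q c0 Y - m * h) * k)%C by ring.
  eapply Rle_trans; [apply Cmod_triangle |]. rewrite Cmod_opp, Cmod_mult.
  pose proof (Rmult_le_compat_r (Cmod k) _ _ (Cmod_ge_0 k) Hq). lra.
Qed.

(** * From the closed interval to the whole line *)

(* Precomposing with [clamp] makes functions on [[0, Y]] continuous on all of R,
   so that one-sided notions at the end points never have to be handled. *)
Definition clamp (Y s : R) : R := Rmax 0 (Rmin Y s).

Lemma clamp_bounds (Y s : R) : 0 <= Y -> 0 <= clamp Y s <= Y.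
Proof. unfold clamp, Rmax, Rmin. intros; repeat destruct Rle_dec; lra. Qed.

Lemma clamp_id (Y s : R) : 0 <= s <= Y -> clamp Y s = s.
Proof. unfold clamp, Rmax, Rmin. intros; repeat destruct Rle_dec; lra. Qed.

Lemma clamp_lipschitz (Y s x : R) : Rabs (clamp Y x - clamp Y s) <= Rabs (x - s).
Proof.
  unfold clamp, Rmax, Rmin.
  repeat destruct Rle_dec; unfold Rabs; repeat destruct Rcase_abs; lra.
Qed.

Lemma curve_continuous_clamp (Y : R) (f : R -> C) :
  0 <= Y ->
  continuous_on (T := R_UniformSpace) (U := C_UniformSpace)
    (fun s => 0 <= s <= Y) f ->
  forall s, curve_continuous (fun x => f (clamp Y x)) s.
Proof.
  intros HY Hf s.
  assert (H : continuous (U := C_UniformSpace) (fun x => f (clamp Y x)) s).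
  { unfold continuous. eapply filterlim_comp; [| apply Hf, clamp_bounds, HY].
    intros Q [eps HQ]. exists eps. intros x Hx.
    apply HQ; [| apply clamp_bounds, HY].
    change (Rabs (clamp Y x - clamp Y s) < eps).
    eapply Rle_lt_trans; [apply clamp_lipschitz | exact Hx]. }
  split.
  - apply (continuous_comp (V := C_UniformSpace) _ Re _ H).
    destruct (f (clamp Y s)) as [u v]. apply (continuous_fst u v).
  - apply (continuous_comp (V := C_UniformSpace) _ Im _ H).
    destruct (f (clamp Y s)) as [u v]. apply (continuous_snd u v).
Qed.

Lemma is_derive_on_continuous (Y : R) (f l : R -> C) :
  (forall s, 0 <= s <= Y -> is_derive_on 0 Y f s (l s)) ->
  continuous_on (T := R_UniformSpace) (U := C_UniformSpace)
    (fun s => 0 <= s <= Y) f.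
Proof.
  intros H s Hs.
  apply (filterdiff_continuous_aux (K := R_AbsRing) (U := R_NormedModule)
    (V := C_R_NormedModule) f).
  - exists (fun h : R_NormedModule => scal (V := C_R_NormedModule) h (l s)).
    apply H, Hs.
  - intros Q HQ. apply (filter_le_within (F := locally s) _ Q HQ).
Qed.

(** Near an interior point [clamp Y] is the identity and the filter restricted to [0, Y] is the full
    neighbourhood filter, so the relative derivative is an ordinary one. *)
Lemma is_derive_on_interior (Y : R) (f : R -> C) (s : R) (l : C) :
  0 < s < Y -> is_derive_on 0 Y f s l ->
  curve_derive (fun x => f (clamp Y x)) s l.
Proof.
  intros Hs [Hlin Hdom].
  assert (Hnear : locally s (fun x => 0 <= x <= Y)).
  { assert (Hd : 0 < Rmin s (Y - s)) by (apply Rmin_pos; lra).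
    exists (mkposreal _ Hd). intros x Hx.
    change (Rabs (x - s) < Rmin s (Y - s)) in Hx.
    pose proof (Rmin_l s (Y - s)); pose proof (Rmin_r s (Y - s)).
    apply Rabs_def2 in Hx. lra. }
  assert (Hd : filterdiff (K := R_AbsRing) (U := R_NormedModule)
    (V := C_R_NormedModule) (fun x => f (clamp Y x)) (locally s)
    (fun h : R_NormedModule => scal (V := C_R_NormedModule) h l)).
  { apply (filterdiff_ext_loc (K := R_AbsRing) (U := R_NormedModule)
      (V := C_R_NormedModule) f).
    - apply (filter_imp _ _ (fun x Hx => f_equal f (eq_sym (clamp_id Y x Hx)))).
      exact Hnear.
    - intros x Hx.
      assert (E : s = x) by (apply (is_filter_lim_locally_unique
        (K := R_AbsRing) (V := R_NormedModule)), Hx).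
      subst x. rewrite clamp_id by lra. reflexivity.
    - split; [exact Hlin |]. intros x Hx eps.
      assert (Hx' : is_filter_lim (T := R_UniformSpace)
        (within (fun x => 0 <= x <= Y) (locally s)) x).
      { intros Q HQ. apply (filter_le_within (F := locally s)), Hx, HQ. }
      specialize (Hdom x Hx' eps).
      unfold within in Hdom.
      generalize (filter_and (F := locally s) _ _ Hdom Hnear).
      apply filter_imp. intros y [H1 H2]. apply H1, H2. }
  split.
  - eapply filterdiff_ext_lin.
    + apply (filterdiff_comp' (K := R_AbsRing) (U := R_NormedModule)
        (V := C_R_NormedModule) (W := R_NormedModule) _ fst s _ fst Hd).
      apply (filterdiff_linear (K := R_AbsRing) (U := C_R_NormedModule)
        (V := R_NormedModule)).
      apply (is_linear_fst (U := R_NormedModule) (V := R_NormedModule)).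
    + reflexivity.
  - eapply filterdiff_ext_lin.
    + apply (filterdiff_comp' (K := R_AbsRing) (U := R_NormedModule)
        (V := C_R_NormedModule) (W := R_NormedModule) _ snd s _ snd Hd).
      apply (filterdiff_linear (K := R_AbsRing) (U := C_R_NormedModule)
        (V := R_NormedModule)).
      apply (is_linear_snd (U := R_NormedModule) (V := R_NormedModule)).
    + reflexivity.
Qed.

(** * Continuity of the profiles along the contour *)

Lemma filterlim_RtoC (x : R) :
  filterlim RtoC (locally x) (locally (T := C_UniformSpace) (RtoC x)).
Proof.
  intros Q [eps HQ]. exists eps. intros y Hy. apply HQ.
  split; [exact Hy | apply ball_center].
Qed.

Lemma smooth_on_continuous (a b : R) (f : R -> R) :
  smooth_on a b f ->
  exists g, (forall x, continuous g x) /\ (forall x, a <= x <= b -> g x = f x).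
Proof.
  intros [g [Hg Hgf]]. exists g. split; [| exact Hgf].
  intros x. apply (ex_derive_continuous (K := R_AbsRing) (V := R_NormedModule)).
  apply (Hg 1%nat).
Qed.

Lemma analytic_continuous (f : C -> C) (z0 : C) :
  analytic_at f z0 -> filterlim f (locally (T := C_UniformSpace) z0)
    (locally (T := C_UniformSpace) (f z0)).
Proof.
  intros Hf. destruct (analytic_has_tangent f z0 Hf) as [l Hl].
  destruct (has_tangent_bounds f z0 l 1 Hl Rlt_0_1) as [B [r [HB [Hr H]]]].
  intros Q HQ. destruct (proj1 (locally_C _ _) HQ) as [eps HQ'].
  apply (proj2 (locally_C _ _)).
  assert (Hd : 0 < Rmin r (eps / (B + 1))).
  { apply Rmin_pos; [lra |].
    apply Rdiv_lt_0_compat; [apply cond_pos | lra]. }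
  exists (mkposreal _ Hd). intros z Hz.
  change (Cmod (z - z0) < Rmin r (eps / (B + 1))) in Hz.
  apply HQ'. change (Cmod (f z - f z0) < eps).
  pose proof (Rmin_l r (eps / (B + 1))); pose proof (Rmin_r r (eps / (B + 1))).
  destruct (H z) as [_ Hz2]; [lra |].
  pose proof (Cmod_ge_0 (z - z0)).
  assert (Cmod (z - z0) * (B + 1) < eps).
  { apply Rmult_lt_reg_r with (/ (B + 1)); [apply Rinv_0_lt_compat; lra |].
    rewrite Rmult_assoc, Rinv_r by lra. unfold Rdiv in *; lra. }
  lra.
Qed.

(** Off the real segment [fc] may be arbitrary, so continuity of [fc] itself cannot be invoked.
    Where [eta] stays on the segment near s, fc(eta x) equals g(Re(eta x)) for a smooth extension g
    of f, which is a composition of continuous maps. *)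
Lemma filterlim_extension (Y : R) (f : R -> R) (fc : C -> C) (eta : R -> C)
    (s : R) :
  smooth_on 0 Y f -> extends Y f fc -> 0 <= s <= Y ->
  continuous_on (T := R_UniformSpace) (U := C_UniformSpace)
    (fun s => 0 <= s <= Y) eta ->
  locally s (fun x => 0 <= x <= Y ->
    exists y, 0 <= y <= Y /\ eta x = RtoC y) ->
  filterlim (fun x => fc (eta x)) (within (fun x => 0 <= x <= Y) (locally s))
    (locally (T := C_UniformSpace) (fc (eta s))).
Proof.
  intros Hf Hext Hs Heta Hreal.
  destruct (smooth_on_continuous 0 Y f Hf) as [g [Hg Hgf]].
  assert (Hval : forall x y, 0 <= y <= Y -> eta x = RtoC y ->
    RtoC (g (Re (eta x))) = fc (eta x)).
  { intros x y Hy E. rewrite E, Hext by exact Hy. cbn. rewrite Hgf by exact Hy.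
    reflexivity. }
  destruct (locally_singleton _ _ Hreal Hs) as [y0 [Hy0 E0]].
  rewrite <- (Hval s y0 Hy0 E0).
  apply (filterlim_ext_loc (fun x => RtoC (g (Re (eta x))))).
  - unfold within. generalize Hreal. apply filter_imp. intros x Hx Dx.
    destruct (Hx Dx) as [y [Hy E]]. exact (Hval x y Hy E).
  - eapply filterlim_comp; [| apply filterlim_RtoC].
    eapply filterlim_comp; [| apply Hg].
    eapply filterlim_comp; [apply Heta, Hs |].
    destruct (eta s) as [u v]. apply (continuous_fst u v).
Qed.

(** Each parameter falls under one of two cases: [eta s] lies in the open set where the profiles are
    analytic and [Tc] has no zero, or [eta] runs inside the real segment near s, where smoothness of
    the flow and T > 0 take over. *)
Lemma contour_regular (Y : R) (U T : R -> R) (Uc Tc : C -> C) (c0 : C)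
    (eta deta : R -> C) :
  base_flow Y U T -> extends Y U Uc -> extends Y T Tc ->
  contour Y U Uc Tc c0 eta deta ->
  eta 0 = 0 /\ eta Y = RtoC Y /\
  (forall s, 0 <= s <= Y -> Tc (eta s) <> 0) /\
  continuous_on (T := R_UniformSpace) (U := C_UniformSpace)
    (fun s => 0 <= s <= Y) deta /\
  continuous_on (T := R_UniformSpace) (U := C_UniformSpace)
    (fun s => 0 <= s <= Y) (fun s => Uc (eta s)) /\
  continuous_on (T := R_UniformSpace) (U := C_UniformSpace)
    (fun s => 0 <= s <= Y) (fun s => Tc (eta s)).
Proof.
  intros Hflow HU HT Hcont.
  destruct Hflow as [HY HUs HTs HTpos _ _ _].
  assert (HTreal : forall s y, 0 <= y <= Y -> eta s = RtoC y -> Tc (eta s) <> 0).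
  { intros s y Hy E. rewrite E, HT by exact Hy. intros E0.
    apply RtoC_inj in E0. specialize (HTpos y). lra. }
  destruct Hcont as [[_ Hseg] | [_ [Hd [Hdc [Om [H [_ [Han [_ [Hend [Hpath [Hcase _]]]]]]]]]]]].
  - assert (Heta : continuous_on (T := R_UniformSpace) (U := C_UniformSpace)
      (fun s => 0 <= s <= Y) eta).
    { apply (continuous_on_ext _ RtoC); [intros s Hs; symmetry; apply Hseg, Hs |].
      apply continuous_on_forall. intros s _. apply filterlim_RtoC. }
    assert (Hreal : forall s, locally s (fun x => 0 <= x <= Y ->
      exists y, 0 <= y <= Y /\ eta x = RtoC y)).
    { intros s. apply filter_forall. intros x Hx. exists x.
      split; [exact Hx | apply Hseg, Hx]. }
    repeat split; try (apply Hseg; lra).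
    + intros s Hs. apply (HTreal s s Hs), Hseg, Hs.
    + apply (continuous_on_ext _ (fun _ => RtoC 1)).
      * intros s Hs; symmetry; apply Hseg, Hs.
      * apply continuous_on_forall. intros s _. apply continuous_const.
    + intros s Hs. apply (filterlim_extension Y U Uc eta s); auto.
    + intros s Hs. apply (filterlim_extension Y T Tc eta s); auto.
  - assert (Heta : continuous_on (T := R_UniformSpace) (U := C_UniformSpace)
      (fun s => 0 <= s <= Y) eta) by (apply (is_derive_on_continuous Y _ deta Hd)).
    assert (H01 : 0 <= 1 <= 1) by lra.
    (* [eta] is stage 1 of the deformation; where the deformation is stationary near s, it agrees
       with stage 0, whose points lie on the real segment. *)
    assert (Hreal : forall s, 0 <= s <= Y -> Om (eta s) \/
      locally s (fun x => 0 <= x <= Y -> exists y, 0 <= y <= Y /\ eta x = RtoC y)).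
    { intros s Hs. destruct (Hcase s Hs) as [HOm | Hloc].
      - left. rewrite <- (proj2 (Hpath s Hs)). apply HOm, H01.
      - right. generalize Hloc. apply filter_imp. intros x Hx Dx.
        destruct (Hpath x Dx) as [[y [Hy E]] E1]. exists y.
        split; [exact Hy |]. rewrite <- E1, (Hx Dx 1 H01). exact E. }
    split; [| split; [| split; [| split; [exact Hdc | split]]]].
    + rewrite <- (proj2 (Hpath 0 ltac:(lra))). apply (Hend 1 H01).
    + rewrite <- (proj2 (Hpath Y ltac:(lra))). apply (Hend 1 H01).
    + intros s Hs. destruct (Hreal s Hs) as [HOm | Hloc].
      * apply Han, HOm.
      * destruct (locally_singleton _ _ Hloc Hs) as [y [Hy E]].
        exact (HTreal s y Hy E).
    + intros s Hs. destruct (Hreal s Hs) as [HOm | Hloc].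
      * eapply filterlim_comp; [apply Heta, Hs |].
        apply analytic_continuous, Han, HOm.
      * apply (filterlim_extension Y U Uc eta s); auto.
    + intros s Hs. destruct (Hreal s Hs) as [HOm | Hloc].
      * eapply filterlim_comp; [apply Heta, Hs |].
        apply analytic_continuous, Han, HOm.
      * apply (filterlim_extension Y T Tc eta s); auto.
Qed.

(** * The decay rate and the flux at the free-stream end *)

Lemma Cmod_sub_diag (z : C) : Cmod (z - z) = 0.
Proof. replace (z - z)%C with (RtoC 0) by ring. apply Cmod_0. Qed.

(** Differentiating r^2 = 1 - M^2 (1 - c)^2 gives r r' = M^2 (1 - c0), and gamma = alpha r near c0.
    Trapping enters here: Re gamma(c0) > 0 excludes a zero of gamma. *)
Lemma gamma_has_tangent (alpha M : R) (c0 : C) (gamma : C -> C) :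
  0 < alpha -> gamma_branch alpha M c0 gamma ->
  gamma c0 <> 0 /\
  (gamma c0 ^ 2 = RtoC alpha ^ 2 * sonic M c0)%C /\
  exists l, has_tangent gamma c0 l /\
    (gamma c0 * l = RtoC alpha ^ 2 * RtoC M ^ 2 * (1 - c0))%C.
Proof.
  intros Ha [r [Hr [Hloc Hre]]].
  destruct (locally_Cmod _ _ Hloc) as [d [Hd H]].
  assert (H0 : Cmod (c0 - c0) < d) by (rewrite Cmod_sub_diag; exact Hd).
  destruct (H c0 H0) as [Hr0 Hg0].
  split.
  { intros E. rewrite E in Hre. simpl in Hre. lra. }
  split.
  { rewrite Hg0, <- Hr0. ring. }
  destruct (analytic_has_tangent r c0 Hr) as [l Hl].
  assert (Hsq : (l * r c0 + r c0 * l = 2 * RtoC M ^ 2 * (1 - c0))%C).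
  { apply (has_tangent_unique (fun c => r c * r c)%C c0).
    - apply has_tangent_mult; exact Hl.
    - apply (has_tangent_ext
        (fun c => 1 + - RtoC M ^ 2 * ((1 + - (1) * c) * (1 + - (1) * c)))%C _ _ _ d Hd).
      + intros c Hc. destruct (H c Hc) as [E _].
        transitivity (r c ^ 2)%C; [rewrite E; unfold sonic |]; ring.
      + set (lin := fun c : C => (1 + - (1) * c)%C).
        assert (Hlin : has_tangent lin c0 (0 + (0 * c0 + - (1) * 1))%C).
        { apply has_tangent_plus; [apply has_tangent_const |].
          apply (has_tangent_mult (fun _ => - (1))%C (fun c => c));
            [apply has_tangent_const | apply has_tangent_id]. }
        replace (2 * RtoC M ^ 2 * (1 - c0))%C with
          (0 + (0 * (lin c0 * lin c0) + - RtoC M ^ 2 *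
            ((0 + (0 * c0 + - (1) * 1)) * lin c0
              + lin c0 * (0 + (0 * c0 + - (1) * 1)))))%C
          by (unfold lin; ring).
        apply (has_tangent_plus (fun _ => RtoC 1)
          (fun c => - RtoC M ^ 2 * (lin c * lin c))%C);
          [apply has_tangent_const |].
        apply (has_tangent_mult (fun _ => - RtoC M ^ 2)%C
          (fun c => lin c * lin c)%C); [apply has_tangent_const |].
        apply has_tangent_mult; exact Hlin. }
  exists (0 * r c0 + RtoC alpha * l)%C. split.
  - apply (has_tangent_ext (fun c => RtoC alpha * r c)%C _ _ _ d Hd).
    + intros c Hc. symmetry. apply H, Hc.
    + apply (has_tangent_mult (fun _ => RtoC alpha) r);
        [apply has_tangent_const | exact Hl].
  - rewrite Hg0.
    replace (RtoC alpha ^ 2 * RtoC M ^ 2 * (1 - c0))%C with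
      (RtoC alpha ^ 2 / 2 * (2 * RtoC M ^ 2 * (1 - c0)))%C
      by field.
    rewrite <- Hsq. field.
Qed.

(* The flux is [Phi * dP] at [y = y_b], where [U = T = 1]. *)
Lemma boundary_flux_has_tangent (alpha M : R) (c0 : C) (gamma : C -> C) :
  0 < alpha -> c0 <> 1 -> gamma_branch alpha M c0 gamma ->
  has_tangent (fun c => - gamma c * / ((1 - c) * (1 - c)))%C c0
    (- (2 / (1 - c0) ^ 3 *
        ((gamma c0 ^ 2 + RtoC alpha ^ 2) / (2 * gamma c0))))%C.
Proof.
  intros Ha Hc1 Hg.
  destruct (gamma_has_tangent alpha M c0 gamma Ha Hg) as [Hg0 [Hg2 [l [Hl El]]]].
  assert (Hnz : (1 - c0)%C <> 0) by (apply Cminus_eq_contra; auto).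
  set (lin := fun c : C => (1 + - (1) * c)%C).
  assert (Hlin : has_tangent lin c0 (0 + (0 * c0 + - (1) * 1))%C).
  { apply has_tangent_plus; [apply has_tangent_const |].
    apply (has_tangent_mult (fun _ => - (1))%C (fun c => c));
      [apply has_tangent_const | apply has_tangent_id]. }
  assert (Elin : forall c, lin c = (1 - c)%C) by (intros; unfold lin; ring).
  assert (Hlin0 : (lin c0 * lin c0)%C <> 0)
    by (rewrite Elin; apply Cmult_neq_0; exact Hnz).
  pose proof (has_tangent_mult _ _ _ _ _ Hlin Hlin) as Hsq.
  pose proof (has_tangent_inv (fun c => lin c * lin c)%C _ _ Hlin0 Hsq) as Hinv.
  pose proof (has_tangent_mult (fun _ => - (1))%C gamma _ _ _
    (has_tangent_const (- (1))%C c0) Hl) as Hneg.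
  pose proof (has_tangent_mult _ _ _ _ _ Hneg Hinv) as Hall.
  cbv beta in Hall.
  apply (has_tangent_ext (fun c => - (1) * gamma c * / (lin c * lin c))%C _ _ _ 1
    Rlt_0_1).
  { intros c _. rewrite Elin. ring. }
  eapply eq_rect; [exact Hall |].
  rewrite !Elin.
  assert (E : l = (RtoC alpha ^ 2 * RtoC M ^ 2 * (1 - c0) / gamma c0)%C)
    by (rewrite <- El; field; exact Hg0).
  (* The sonic relation alpha^2 M^2 (1 - c0)^2 = alpha^2 - gamma^2 eliminates M. The derivative of
     -gamma/(1 - c)^2 then collapses to -(gamma^2 + alpha^2)/(gamma (1 - c0)^3), minus the boundary
     term of [I] for unit pressure at [y_b]. *)
  assert (E2 : (RtoC alpha ^ 2 * RtoC M ^ 2 * (1 - c0) =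
    (RtoC alpha ^ 2 - gamma c0 ^ 2) / (1 - c0))%C)
    by (rewrite Hg2; unfold sonic; field; exact Hnz).
  rewrite E, E2. field. repeat split; assumption.
Qed.

(** * The Rayleigh equation as a linear system *)

(** The first coefficient is a quadratic polynomial in c, with exact remainder (e/t) h^2. For the
    second, with w = u - c0, 1/(w - h)^2 - 1/w^2 - 2h/w^3 = h^2 (3w - 2h) / (w^3 (w - h)^2). A
    positive minimum m of |w| on [0, Y] and the restriction |h| < m/2 keep w - h away from 0,
    uniformly in s. *)
Lemma rayleigh_coefficients (Y : R) (u t e : R -> C) (c0 k M2 : C) :
  0 <= Y ->
  (forall s, curve_continuous u s /\ curve_continuous t s /\
    curve_continuous e s) ->
  (forall s, t s <> 0 /\ (u s - c0)%C <> 0) ->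
  exists X r, 0 <= X /\ 0 < r <= 1 /\
    forall c s, Cmod (c - c0) < r -> 0 <= s <= Y ->
    (u s - c)%C <> 0 /\
    Cmod (e s * (u s - c0) ^ 2 * / t s) <= X /\
    Cmod (k * (t s * / (u s - c0) ^ 2 - M2) * e s) <= X /\
    Cmod (e s * (u s - c) ^ 2 * / t s - e s * (u s - c0) ^ 2 * / t s
      - - (2) * (u s - c0) * e s * / t s * (c - c0))
      <= X * Cmod (c - c0) ^ 2 /\
    Cmod (k * (t s * / (u s - c) ^ 2 - M2) * e s
      - k * (t s * / (u s - c0) ^ 2 - M2) * e s
      - 2 * k * t s * e s * / (u s - c0) ^ 3 * (c - c0))
      <= X * Cmod (c - c0) ^ 2.
Proof.
  intros HY Hcont Hnz.
  assert (Hw : forall s, curve_continuous (fun s => u s - c0)%C s).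
  { intros s. apply curve_continuous_minus;
      [apply Hcont | apply curve_continuous_const]. }
  assert (Hw2 : forall s, curve_continuous (fun s => / (u s - c0) ^ 2)%C s).
  { intros s. apply (curve_continuous_inv (fun s => (u s - c0) ^ 2)%C).
    - apply Cpow_nz, Hnz.
    - apply (curve_continuous_sqr (fun s => u s - c0)%C), Hw. }
  assert (Hti : forall s, curve_continuous (fun s => / t s)%C s).
  { intros s. apply curve_continuous_inv; [apply Hnz | apply Hcont]. }
  destruct (curve_continuous_bounded (fun s => e s * / t s)%C Y HY)
    as [X1 [HX1 HX1']].
  { intros s. apply curve_continuous_mult; [apply Hcont | apply Hti]. }
  destruct (curve_continuous_bounded (fun s => e s * (u s - c0) ^ 2 * / t s)%C Y HY)
    as [X2 [HX2 HX2']].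
  { intros s. apply curve_continuous_mult; [| apply Hti].
    apply curve_continuous_mult; [apply Hcont |].
    apply (curve_continuous_sqr (fun s => u s - c0)%C), Hw. }
  destruct (curve_continuous_bounded
    (fun s => k * (t s * / (u s - c0) ^ 2 - M2) * e s)%C Y HY) as [X3 [HX3 HX3']].
  { intros s. apply curve_continuous_mult; [| apply Hcont].
    apply (curve_continuous_mult (fun _ => k)); [apply curve_continuous_const |].
    apply (curve_continuous_minus _ (fun _ => M2));
      [| apply curve_continuous_const].
    apply curve_continuous_mult; [apply Hcont | apply Hw2]. }
  destruct (curve_continuous_bounded
    (fun s => k * t s * e s * / (u s - c0) ^ 3)%C Y HY) as [X4 [HX4 HX4']].
  { intros s. apply curve_continuous_mult.
    - apply curve_continuous_mult; [| apply Hcont].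
      apply (curve_continuous_mult (fun _ => k));
        [apply curve_continuous_const | apply Hcont].
    - apply (curve_continuous_inv (fun s => (u s - c0) ^ 3)%C).
      + apply Cpow_nz, Hnz.
      + apply (curve_continuous_mult (fun s => u s - c0)%C
          (fun s => (u s - c0) ^ 2)%C); [apply Hw |].
        apply (curve_continuous_sqr (fun s => u s - c0)%C), Hw. }
  destruct (curve_continuous_bounded (fun s => u s - c0)%C Y HY Hw)
    as [X5 [HX5 HX5']].
  destruct (curve_continuous_bounded_below (fun s => u s - c0)%C Y HY Hw)
    as [m [Hm Hm']].
  { intros s _. apply Hnz. }
  (* Bounds the remainder factor of the second coefficient: [X4] for k t e / w^3, [3 * X5 + 2] for
     3w - 2h with |h| <= 1, and (m/2)^2 below |w - h|^2. *)
  set (K := X4 * (3 * X5 + 2) * / (m / 2) ^ 2).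
  assert (Hm2 : 0 < (m / 2) ^ 2) by (apply pow_lt; lra).
  assert (HK : 0 <= K).
  { unfold K. repeat apply Rmult_le_pos; try lra.
    left; apply Rinv_0_lt_compat, Hm2. }
  exists (X1 + X2 + X3 + K), (Rmin 1 (m / 2)).
  split; [lra |]. split; [split; [apply Rmin_pos; lra | apply Rmin_l] |].
  intros c s Hc Hs.
  pose proof (Rmin_l 1 (m / 2)); pose proof (Rmin_r 1 (m / 2)).
  specialize (HX1' s Hs); specialize (HX2' s Hs); specialize (HX3' s Hs);
  specialize (HX4' s Hs); specialize (HX5' s Hs); specialize (Hm' s Hs).
  destruct (Hnz s) as [Ht Hu0].
  assert (Hlow : m / 2 <= Cmod (u s - c)).
  { replace (u s - c0)%C with ((u s - c) + (c - c0))%C in Hm' by ring.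
    pose proof (Cmod_triangle (u s - c) (c - c0)). lra. }
  assert (Huc : (u s - c)%C <> 0) by (apply Cmod_gt_0; lra).
  pose proof (Cmod_ge_0 (c - c0)) as Hh.
  assert (Hh2 : 0 <= Cmod (c - c0) ^ 2) by apply pow2_ge_0.
  split; [exact Huc |]. split; [lra |]. split; [lra |]. split.
  - replace (e s * (u s - c) ^ 2 * / t s - e s * (u s - c0) ^ 2 * / t s
      - - (2) * (u s - c0) * e s * / t s * (c - c0))%C
      with (e s * / t s * (c - c0) ^ 2)%C by ring.
    rewrite Cmod_mult, Cmod_pow. apply Rmult_le_compat_r; lra.
  - replace (k * (t s * / (u s - c) ^ 2 - M2) * e s
      - k * (t s * / (u s - c0) ^ 2 - M2) * e s
      - 2 * k * t s * e s * / (u s - c0) ^ 3 * (c - c0))%C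
      with (k * t s * e s * / (u s - c0) ^ 3
        * (3 * (u s - c0) - 2 * (c - c0)) * / (u s - c) ^ 2 * (c - c0) ^ 2)%C
      by (field; split; assumption).
    rewrite Cmod_mult, Cmod_pow. apply Rmult_le_compat_r; [exact Hh2 |].
    apply Rle_trans with K; [| lra].
    rewrite Cmod_mult, Cmod_inv, Cmod_pow by (apply Cpow_nz; exact Huc).
    rewrite Cmod_mult. unfold K.
    apply Rmult_le_compat.
    + apply Rmult_le_pos; apply Cmod_ge_0.
    + left; apply Rinv_0_lt_compat, pow_lt. lra.
    + apply Rmult_le_compat; try apply Cmod_ge_0; [exact HX4' |].
      replace (3 * (u s - c0) - 2 * (c - c0))%C
        with (RtoC 3 * (u s - c0) + - (RtoC 2 * (c - c0)))%C by ring.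
      eapply Rle_trans; [apply Cmod_triangle |].
      rewrite Cmod_opp, !Cmod_mult, !Cmod_R, !Rabs_pos_eq by lra. lra.
    + apply Rinv_le_contravar; [exact Hm2 |]. apply pow_incr. lra.
Qed.

(** With the flux q = Phi dp the equation is first order and Phi is never differentiated: p' =
    (eta'/Phi) q. The factor k rescales [P] to the multiple that is the given eigenfunction at
    c0. *)
Lemma rayleigh_system (alpha M Y : R) (Uc Tc : C -> C) (eta deta : R -> C)
    (c k : C) (p dp : R -> C) :
  0 <= Y ->
  (forall s, 0 <= s <= Y -> Tc (eta s) <> 0 /\ (Uc (eta s) - c)%C <> 0) ->
  rayleigh_solution alpha M Y Uc Tc eta deta c p dp ->
  system_solution Y
    (fun s => deta (clamp Y s) * (Uc (eta (clamp Y s)) - c) ^ 2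
      * / Tc (eta (clamp Y s)))%C
    (fun s => RtoC alpha ^ 2 * (Tc (eta (clamp Y s))
      * / (Uc (eta (clamp Y s)) - c) ^ 2 - RtoC M ^ 2) * deta (clamp Y s))%C
    (fun s => k * p (clamp Y s))%C
    (fun s => k * (Phi Uc Tc c (eta (clamp Y s)) * dp (clamp Y s)))%C.
Proof.
  intros HY Hnz Hsol. set (q := fun x => (Phi Uc Tc c (eta x) * dp x)%C).
  split.
  - intros s.
    split; apply (curve_continuous_mult (fun _ => k));
      try apply curve_continuous_const.
    + apply curve_continuous_clamp; [exact HY |].
      apply (is_derive_on_continuous Y p _ (fun x Hx => proj1 (Hsol x Hx))).
    + apply (curve_continuous_clamp Y q HY).
      apply (is_derive_on_continuous Y q _ (fun x Hx => proj2 (Hsol x Hx))).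
  - intros s Hs. assert (Hs' : 0 <= s <= Y) by lra.
    destruct (Hsol s Hs') as [Hp Hq]. destruct (Hnz s Hs') as [Ht Hu].
    rewrite (clamp_id Y s Hs'). split.
    + replace (deta s * (Uc (eta s) - c) ^ 2 * / Tc (eta s)
        * (k * (Phi Uc Tc c (eta s) * dp s)))%C
        with (0 * p (clamp Y s) + k * (dp s * deta s))%C
        by (unfold Phi; field; split; assumption).
      apply (curve_derive_mult (fun _ => k) (fun s => p (clamp Y s)));
        [apply curve_derive_const |].
      apply (is_derive_on_interior Y p); assumption.
    + replace (RtoC alpha ^ 2 * (Tc (eta s) * / (Uc (eta s) - c) ^ 2 - RtoC M ^ 2)
        * deta s * (k * p s))%C with
        (0 * q (clamp Y s) + k * (RtoC alpha ^ 2
          * (Phi Uc Tc c (eta s) - RtoC M ^ 2) * p s * deta s))%C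
        by (unfold Phi; field; assumption).
      apply (curve_derive_mult (fun _ => k) (fun s => q (clamp Y s)));
        [apply curve_derive_const |].
      apply (is_derive_on_interior Y q); assumption.
Qed.

Lemma dispersion_rigid (alpha Tw : R) (P dP : C -> R -> C) (c : C) :
  dispersion alpha Tw P dP c 0 = dP c 0.
Proof. unfold dispersion, Cdiv. ring. Qed.

(** The dispersion function is built from [P], equal to 1 at [y_b], while [I] is quadratic in p0 = k
    P; p0(0)^2 against P(c0) at the wall compensates the scale k^2. The undivided form lets I <> 0
    be read off from l <> 0. *)
Lemma rayleigh_sensitivity (alpha M Y : R) (U T : R -> R) (Uc Tc : C -> C)
    (eta deta : R -> C) (gamma : C -> C) (P dP : C -> R -> C) (c0 : C)
    (p0 dp0 : R -> C) :
  0 < alpha -> base_flow Y U T -> extends Y U Uc -> extends Y T Tc ->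
  simple_trapped_eigenvalue alpha M Y U T Uc Tc eta deta gamma P dP c0 ->
  is_eigenfunction Y P dP c0 p0 dp0 ->
  c0 <> 0 /\ P c0 0 <> 0 /\
  (exists B r, 0 < r /\ forall c, Cmod (c - c0) < r ->
    Cmod (P c 0 - P c0 0) <= B * Cmod (c - c0)) /\
  exists l : C, l <> 0 /\ has_tangent (fun c => dP c 0) c0 l /\
    (RtoC (T 0) * l * p0 0 ^ 2 = - (c0 ^ 2 * P c0 0 *
      sens_I alpha Y Uc Tc eta deta c0 (gamma c0) p0 dp0))%C.
Proof.
  intros Ha Hflow HU HT Heig [k [Hk Hp0]].
  destruct Heig as [Hcont Hreg Hgam Hsols Hzero Hsimple].
  destruct (contour_regular Y U T Uc Tc c0 eta deta Hflow HU HT Hcont)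
    as [Heta0 [HetaY [HTnz [Hdetac [HUcc HTcc]]]]].
  destruct Hflow as [HY0 _ _ HTpos HU0 HU1 HT1].
  assert (HY : 0 <= Y) by lra.
  assert (HIY0 : 0 <= 0 <= Y) by lra. assert (HIYY : 0 <= Y <= Y) by lra.
  assert (Hclamp0 : clamp Y 0 = 0) by (apply clamp_id, HIY0).
  assert (HclampY : clamp Y Y = Y) by (apply clamp_id, HIYY).
  assert (EU0 : Uc (eta 0) = 0) by (rewrite Heta0, HU, HU0 by exact HIY0; reflexivity).
  assert (ET0 : Tc (eta 0) = RtoC (T 0)) by (rewrite Heta0, HT by exact HIY0; reflexivity).
  assert (EUY : Uc (eta Y) = 1) by (rewrite HetaY, HU, HU1 by lra; reflexivity).
  assert (ETY : Tc (eta Y) = 1) by (rewrite HetaY, HT, HT1 by lra; reflexivity).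
  assert (HTw : RtoC (T 0) <> 0).
  { intros E. apply RtoC_inj in E. specialize (HTpos 0). lra. }
  destruct (locally_Cmod _ _ Hreg) as [r1 [Hr1 Hreg']].
  destruct (locally_Cmod _ _ Hsols) as [r2 [Hr2 Hsols']].
  assert (Hu0 : forall s, 0 <= s <= Y -> (Uc (eta s) - c0)%C <> 0).
  { intros s Hs. apply Cminus_eq_contra, Hreg'; [| exact Hs].
    rewrite Cmod_sub_diag; exact Hr1. }
  (* U takes the values 0 and 1 at the two ends of the contour, and c0 avoids every value of U on
     it. *)
  assert (Hc00 : c0 <> 0).
  { intros E. apply (Hu0 0 HIY0). rewrite EU0, E. ring. }
  assert (Hc01 : c0 <> 1).
  { intros E. apply (Hu0 Y HIYY). rewrite EUY, E. ring. }
  assert (Hc01' : (1 - c0)%C <> 0) by (apply Cminus_eq_contra; auto).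
  set (u := fun s => Uc (eta (clamp Y s))).
  set (t := fun s => Tc (eta (clamp Y s))).
  set (e := fun s => deta (clamp Y s)).
  assert (Hcurves : forall s, curve_continuous u s /\ curve_continuous t s /\
    curve_continuous e s).
  { intros s. split; [| split].
    - apply (curve_continuous_clamp Y (fun x => Uc (eta x)) HY HUcc).
    - apply (curve_continuous_clamp Y (fun x => Tc (eta x)) HY HTcc).
    - apply (curve_continuous_clamp Y deta HY Hdetac). }
  assert (Hnz : forall s, t s <> 0 /\ (u s - c0)%C <> 0).
  { intros s. pose proof (clamp_bounds Y s HY).
    split; [apply HTnz | apply Hu0]; assumption. }
  destruct (rayleigh_coefficients Y u t e c0 (RtoC alpha ^ 2)%C (RtoC M ^ 2)%C
    HY Hcurves Hnz) as [X [r3 [HX [Hr3 Hcoef]]]].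
  set (r := Rmin r3 r2).
  assert (Hr : 0 < r <= 1 /\ r <= r2 /\ r <= r3).
  { unfold r. pose proof (Rmin_l r3 r2); pose proof (Rmin_r r3 r2).
    assert (0 < Rmin r3 r2) by (apply Rmin_pos; lra). lra. }
  assert (Hc0r : Cmod (c0 - c0) < r) by (rewrite Cmod_sub_diag; lra).
  assert (HPY : forall c, Cmod (c - c0) < r ->
    P c Y = 1 /\ dP c Y = (- gamma c)%C).
  { intros c Hc. apply Hsols'. lra. }
  set (a := fun c s => (e s * (u s - c) ^ 2 * / t s)%C).
  set (b := fun c s =>
    (RtoC alpha ^ 2 * (t s * / (u s - c) ^ 2 - RtoC M ^ 2) * e s)%C).
  set (p := fun c s => (k * P c (clamp Y s))%C).
  set (q := fun c s =>
    (k * (Phi Uc Tc c (eta (clamp Y s)) * dP c (clamp Y s)))%C).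
  assert (Hsys : forall c, Cmod (c - c0) < r ->
    system_solution Y (a c) (b c) (p c) (q c)).
  { intros c Hc. apply rayleigh_system; [exact HY | | apply Hsols'; lra].
    intros s Hs. split; [apply HTnz, Hs |].
    destruct (Hcoef c s ltac:(lra) Hs) as [H _]. unfold u in H.
    rewrite (clamp_id Y s Hs) in H. exact H. }
  assert (HpY : forall c, Cmod (c - c0) < r -> p c Y = k).
  { intros c Hc. unfold p. rewrite HclampY, (proj1 (HPY c Hc)). ring. }
  set (flux := (2 / (1 - c0) ^ 3 *
    ((gamma c0 ^ 2 + RtoC alpha ^ 2) / (2 * gamma c0)))%C).
  assert (HqY : has_tangent (fun c => q c Y) c0 (0 * (- gamma c0 * / ((1 - c0)
    * (1 - c0))) + k * - flux)%C).
  { apply (has_tangent_ext (fun c => k * (- gamma c * / ((1 - c) * (1 - c))))%C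
      _ _ _ r); [lra | |].
    - intros c Hc. unfold q, Phi.
      rewrite HclampY, ETY, EUY, (proj2 (HPY c Hc)). unfold Cdiv. simpl Cpow.
      replace ((1 - c) * ((1 - c) * 1))%C with ((1 - c) * (1 - c))%C by ring.
      ring.
    - apply (has_tangent_mult (fun _ => k)
        (fun c => - gamma c * / ((1 - c) * (1 - c)))%C);
        [apply has_tangent_const |].
      apply (boundary_flux_has_tangent alpha M); assumption. }
  set (a1 := fun s => (- (2) * (u s - c0) * e s * / t s)%C).
  set (b1 := fun s => (2 * RtoC alpha ^ 2 * t s * e s * / (u s - c0) ^ 3)%C).
  assert (Hab1 : forall s, curve_continuous a1 s /\ curve_continuous b1 s).
  { intros s. destruct (Hcurves s) as [Hu [Ht He]].
    assert (Hw : curve_continuous (fun s => u s - c0)%C s)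
      by (apply curve_continuous_minus; [exact Hu | apply curve_continuous_const]).
    split; apply curve_continuous_mult.
    - apply curve_continuous_mult; [| exact He].
      apply (curve_continuous_mult (fun _ => - (2))%C); [| exact Hw].
      apply curve_continuous_const.
    - apply curve_continuous_inv; [apply Hnz | exact Ht].
    - apply curve_continuous_mult; [| exact He].
      apply (curve_continuous_mult (fun _ => 2 * RtoC alpha ^ 2)%C); [| exact Ht].
      apply curve_continuous_const.
    - apply (curve_continuous_inv (fun s => (u s - c0) ^ 3)%C).
      + apply Cpow_nz, Hnz.
      + apply (curve_continuous_mult (fun s => u s - c0)%C
          (fun s => (u s - c0) ^ 2)%C); [exact Hw |].
        apply (curve_continuous_sqr (fun s => u s - c0)%C), Hw. }
  destruct (system_sensitivity Y X a b p q a1 b1 c0 k _ r HY HX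
    (proj1 Hr) Hab1 (fun c s Hc Hs => proj2 (Hcoef c s
      (Rlt_le_trans _ _ _ Hc (proj2 (proj2 Hr))) Hs)) Hsys HpY HqY)
    as [[B [r4 [Hr4 HB]]] Htan].
  assert (HdP0 : dP c0 0 = 0) by (rewrite <- (dispersion_rigid alpha (T 0) P dP); exact Hzero).
  (* Otherwise pressure and flux would both vanish at the wall, and uniqueness would force p(Y) = 0
     against p(Y) = k. *)
  assert (HP0 : P c0 0 <> 0).
  { intros E. apply Hk. rewrite <- (HpY c0 Hc0r).
    apply (system_solution_zero Y X (a c0) (b c0) (p c0) (q c0) HY HX).
    - intros s Hs. destruct (Hcoef c0 s ltac:(lra) Hs) as [_ [H1 [H2 _]]].
      split; assumption.
    - apply Hsys, Hc0r.
    - unfold p. rewrite Hclamp0, E. ring.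
    - unfold q. rewrite Hclamp0, HdP0. ring. }
  split; [exact Hc00 |]. split; [exact HP0 |]. split.
  { exists (/ Cmod k * B), r4. split; [exact Hr4 |]. intros c Hc.
    specialize (HB c Hc). unfold p in HB. rewrite Hclamp0 in HB.
    replace (k * P c 0 - k * P c0 0)%C with (k * (P c 0 - P c0 0))%C in HB by ring.
    rewrite Cmod_mult in HB. apply Cmod_gt_0 in Hk.
    apply Rmult_le_reg_l with (Cmod k); [exact Hk |].
    rewrite <- !Rmult_assoc, Rinv_r, Rmult_1_l by lra. exact HB. }
  set (I := sens_I alpha Y Uc Tc eta deta c0 (gamma c0) p0 dp0).
  (* The terms b1 p^2 and -a1 q^2 are the alpha^2 p0^2 and p0'^2 parts of the integrand, because
     Phi^2 (U - c0)/T = T/(U - c0)^3. *)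
  assert (EI : I = (RInt (V := C_R_CompleteNormedModule)
    (fun s => b1 s * p c0 s ^ 2 - a1 s * q c0 s ^ 2)%C 0 Y + flux * k ^ 2)%C).
  { unfold I, sens_I. f_equal.
    - apply (RInt_ext (V := C_R_CompleteNormedModule)).
      rewrite Rmin_left, Rmax_right by lra. intros s Hs.
      assert (Hs' : 0 <= s <= Y) by lra.
      destruct (Hp0 s Hs') as [E1 E2]. rewrite E1, E2.
      pose proof (HTnz s Hs'). pose proof (Hu0 s Hs').
      unfold b1, a1, p, q, u, t, e, Phi. rewrite (clamp_id Y s Hs').
      match goal with |- ?x = ?y => change (@eq C x y) end.
      field. split; assumption.
    - rewrite (proj1 (Hp0 Y HIYY)), (proj1 (HPY c0 Hc0r)). unfold flux.
      destruct (gamma_has_tangent alpha M c0 gamma Ha Hgam) as [Hg0 _].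
      field. repeat split; assumption. }
  match type of Htan with has_tangent _ _ ?m => assert (Em : m = (- I)%C) end.
  { rewrite EI. ring. }
  rewrite Em in Htan. clear Em.
  (* The Wronskian at the wall is k (T_w/c^2) dP(c) p_0, as U = 0 and q_0 = 0 there. Multiplying by
     c^2 and dividing by T_w k p_0 recovers dP(c) on the disc |c - c0| < |c0|, where c is nonzero;
     the derivative of c^2 does not contribute because the Wronskian vanishes at c0. *)
  pose proof (has_tangent_mult _ _ _ _ _ Htan
    (has_tangent_mult _ _ _ _ _ (has_tangent_id c0) (has_tangent_id c0))) as Hl.
  pose proof (has_tangent_mult (fun _ => / (RtoC (T 0) * k * p c0 0))%C _ _ _ _
    (has_tangent_const _ c0) Hl) as Hl'. clear Hl.
  assert (Hp00 : p c0 0 = (k * P c0 0)%C) by (unfold p; rewrite Hclamp0; reflexivity).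
  assert (Hq00 : q c0 0 = 0) by (unfold q; rewrite Hclamp0, HdP0; ring).
  cbv beta in Hl'.
  match type of Hl' with has_tangent _ _ ?m =>
    assert (Em : m = (- I * c0 ^ 2 / (RtoC (T 0) * k ^ 2 * P c0 0))%C) end.
  { rewrite Hp00, Hq00. field. repeat split; assumption. }
  rewrite Em in Hl'. clear Em.
  set (l := (- I * c0 ^ 2 / (RtoC (T 0) * k ^ 2 * P c0 0))%C) in *.
  assert (Hl : has_tangent (fun c => dP c 0) c0 l).
  { revert Hl'. pose proof (proj1 (Cmod_gt_0 _) Hc00) as Hc0p.
    apply (has_tangent_ext _ _ _ _ (Cmod c0) Hc0p).
    intros c Hc. rewrite Hp00, Hq00. unfold q, Phi.
    rewrite Hclamp0, EU0, ET0.
    assert (Hcn : c <> 0).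
    { intros E. rewrite E in Hc. replace (0 - c0)%C with (- c0)%C in Hc by ring.
      rewrite Cmod_opp in Hc. lra. }
    field. repeat split; assumption. }
  exists l. split; [| split; [exact Hl |]].
  - destruct Hsimple as [d [Hd Hdnz]].
    assert (E : d = l); [| rewrite <- E; exact Hdnz].
    rewrite <- (is_C_derive_unique _ _ _ Hd).
    apply is_C_derive_unique, has_tangent_is_derive.
    apply (has_tangent_ext (fun c => dP c 0) _ _ _ 1 Rlt_0_1); [| exact Hl].
    intros c _. symmetry. apply dispersion_rigid.
  - unfold l. fold I. rewrite (proj1 (Hp0 0 HIY0)). field.
    repeat split; assumption.
Qed.

(** * The sector criterion and the growth-rate shift *)

(** Taking k as the floor of (x + PI)/(2 PI), which is [up y - 1], moves x into [-PI, PI), where the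
    sine is negative exactly on the open interval from -PI to 0. *)
Lemma sin_neg_iff (x : R) :
  sin x < 0 <-> exists k : Z, - PI < x - 2 * PI * IZR k < 0.
Proof.
  pose proof PI_RGT_0 as Hpi.
  assert (Hper : forall k : Z, sin (x - 2 * PI * IZR k) = sin x).
  { intros k. assert (Hs : sin (IZR k * PI) = 0) by (apply sin_eq_0_1; exists k; ring).
    replace (2 * PI * IZR k) with (2 * (IZR k * PI)) by ring.
    rewrite sin_minus, sin_2a, cos_2a_sin, Hs. ring. }
  split.
  - intros Hx. set (y := (x + PI) / (2 * PI)).
    destruct (archimed y) as [H1 H2].
    exists (up y - 1)%Z. rewrite <- (Hper (up y - 1)%Z) in Hx.
    rewrite minus_IZR in *. set (z := IZR (up y)) in *.
    assert (Hy : x = 2 * PI * y - PI) by (unfold y; field; lra).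
    assert (Hr : - PI <= x - 2 * PI * (z - 1) < PI) by (rewrite Hy; split; nra).
    split.
    + destruct (proj1 Hr) as [H | H]; [exact H |].
      rewrite <- H, sin_neg, sin_PI in Hx. lra.
    + destruct (Rlt_le_dec (x - 2 * PI * (z - 1)) 0) as [H | H]; [exact H |].
      pose proof (sin_ge_0 _ H). lra.
  - intros [k Hk]. rewrite <- (Hper k). apply sin_lt_0_var; lra.
Qed.

Lemma Im_mult_cis (z : C) (r phi phiz : R) :
  is_phase z phiz ->
  Im (z * (RtoC r * cis phi)) = Cmod z * r * sin (phi + phiz).
Proof.
  intros E. rewrite E at 1. unfold cis, Im. simpl. rewrite sin_plus. ring.
Qed.

Theorem corollary1 :
  forall (alpha M yb : R) (U T : R -> R) (Uc Tc : C -> C) (eta deta : R -> C)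
    (gamma : C -> C) (P dP : C -> R -> C) (c0 : C) (p0 dp0 : R -> C)
    (cA : C -> C),
    0 < alpha -> 0 < M ->
    base_flow yb U T ->
    extends yb U Uc -> extends yb T Tc ->
    simple_trapped_eigenvalue alpha M yb U T Uc Tc eta deta gamma P dP c0 ->
    is_eigenfunction yb P dP c0 p0 dp0 ->
    eigenvalue_branch (dispersion alpha (T 0) P dP) c0 cA ->
    let K :=
      sens_K alpha c0
        (sens_I alpha yb Uc Tc eta deta c0 (gamma c0) p0 dp0) p0 in
    let shift (A : C) (phi phiK : R) :=
      alpha * Cmod K * Cmod A * sin (phi + phiK) in
    (exists B r : R, 0 < r /\
      forall (A : C) (phi phiK : R),
        A <> 0 -> Cmod A < r -> is_phase A phi -> is_phase K phiK ->
        Rabs (alpha * Im (cA A - c0)%C - shift A phi phiK) <= B * Cmod A ^ 2)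
    /\
    (forall (A : C) (phi phiK : R),
      A <> 0 -> is_phase A phi -> is_phase K phiK ->
      (shift A phi phiK < 0 <-> Im (K * cis phi)%C < 0) /\
      (Im (K * cis phi)%C < 0 <->
       exists k : Z,
         - PI - phiK + 2 * PI * IZR k < phi < - phiK + 2 * PI * IZR k)).
Proof.
  intros alpha M yb U T Uc Tc eta deta gamma P dP c0 p0 dp0 cA
    Ha _ Hflow HU HT Heig Hp0 [Hana [HcA0 Hzero]] K shift.
  destruct (rayleigh_sensitivity alpha M yb U T Uc Tc eta deta gamma P dP c0
    p0 dp0 Ha Hflow HU HT Heig Hp0)
    as [Hc0 [HP0 [[B [r [Hr HB]]] [l [Hl [Htan HI]]]]]].
  set (I := sens_I alpha yb Uc Tc eta deta c0 (gamma c0) p0 dp0) in *.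
  assert (HTw : RtoC (T 0) <> 0).
  { intros E. apply RtoC_inj in E.
    pose proof (flow_T_pos _ _ _ Hflow 0). lra. }
  assert (HaC : RtoC alpha <> 0) by (intros E; apply RtoC_inj in E; lra).
  assert (Hp00 : p0 0 <> 0).
  { destruct Hp0 as [k [Hk Hp]]. pose proof (flow_yb _ _ _ Hflow).
    rewrite (proj1 (Hp 0 ltac:(lra))). apply Cmult_neq_0; assumption. }
  (* If I were 0, the sensitivity identity would give T_w l p0(0)^2 = 0, against simplicity of the
     eigenvalue and p0(0) <> 0. *)
  assert (HInz : I <> 0).
  { intros E. rewrite E in HI.
    apply (Cmult_neq_0 (RtoC (T 0) * l) (p0 0 ^ 2)).
    - apply Cmult_neq_0; assumption.
    - apply Cpow_nz, Hp00.
    - rewrite HI. ring. }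
  assert (HK : K <> 0).
  { unfold K, sens_K, Cdiv. fold I. repeat apply Cmult_neq_0; try assumption.
    - exact Ci_nz.
    - exact C1_nz.
    - intros E. apply C1_nz.
      rewrite <- (Cinv_r (c0 * I)) by (apply Cmult_neq_0; assumption).
      rewrite E. ring. }
  destruct (analytic_has_tangent cA 0 Hana) as [m Hm].
  assert (Em : m = K).
  { destruct (has_tangent_bounds cA 0 m 1 Hm Rlt_0_1) as [B1 [r1 [HB1 [Hr1 H1]]]].
    (* The radius r/(B1 + 1) keeps c(A) in the disc where [P c 0] is Lipschitz in c; composing with
       the Lipschitz bound of the branch gives the constant |B| B1. *)
    assert (HPA : has_tangent (fun A => A * P (cA A) 0)%C 0 (P (cA 0) 0)).
    { assert (HBa := Rle_abs B). assert (HB0 := Rabs_pos B).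
      apply (has_tangent_mult_lipschitz (fun A => P (cA A) 0) (Rabs B * B1)
        (Rmin r1 (r / (B1 + 1)))).
      { apply Rmin_pos; [lra | apply Rdiv_lt_0_compat; lra]. }
      intros A HA. pose proof (Cmod_ge_0 A).
      pose proof (Rmin_l r1 (r / (B1 + 1))); pose proof (Rmin_r r1 (r / (B1 + 1))).
      assert (HAs : Cmod A * (B1 + 1) < r).
      { apply Rmult_lt_reg_r with (/ (B1 + 1)); [apply Rinv_0_lt_compat; lra |].
        rewrite Rmult_assoc, Rinv_r by lra. unfold Rdiv in *; lra. }
      specialize (H1 A). replace (A - 0)%C with A in H1 by ring.
      destruct H1 as [_ H1]; [lra |]. rewrite HcA0 in *.
      assert (Hclose : Cmod (cA A - c0) < r) by lra.
      specialize (HB _ Hclose). pose proof (Cmod_ge_0 (cA A - c0)).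
      assert (B * Cmod (cA A - c0) <= Rabs B * Cmod (cA A - c0))
        by (apply Rmult_le_compat_r; lra).
      assert (Rabs B * Cmod (cA A - c0) <= Rabs B * (B1 * Cmod A))
        by (apply Rmult_le_compat_l; lra).
      lra. }
    rewrite HcA0 in HPA.
    assert (HdP : has_tangent (fun A => dP (cA A) 0) 0 (l * m)%C).
    { apply (has_tangent_comp (fun c => dP c 0) cA); [exact Hm |].
      rewrite HcA0. exact Htan. }
    set (f := (Ci * RtoC alpha / RtoC (T 0))%C).
    pose proof (has_tangent_mult (fun _ => f) _ _ _ _
      (has_tangent_const f 0) (has_tangent_mult _ _ _ _ _ Hm HPA)) as Hwall.
    cbv beta in Hwall.
    destruct (locally_Cmod _ _ Hzero) as [r2 [Hr2 Hz]].
    (* The left side is the tangent of D(c(A), A) along the branch, a function that vanishes near A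
       = 0, so uniqueness of tangents makes it 0. The terms with a factor 0 come from the constant f
       and from A evaluated at 0. *)
    assert (E0 : (l * m + (0 * (cA 0 * (0 * P (cA 0) 0))
      + f * (m * (0 * P (cA 0) 0) + cA 0 * P c0 0)))%C = 0).
    { apply (has_tangent_unique (fun _ => RtoC 0) 0).
      - apply (has_tangent_ext _ _ _ _ r2 Hr2)
          with (2 := has_tangent_plus _ _ _ _ _ HdP Hwall).
        intros A HA. rewrite <- (Hz A HA). unfold dispersion, f, Cdiv. ring.
      - apply has_tangent_const. }
    rewrite HcA0 in E0.
    assert (E1 : (l * m = - (f * c0 * P c0 0))%C).
    { replace (l * m)%C with (l * m + (0 * (c0 * (0 * P c0 0))
        + f * (m * (0 * P c0 0) + c0 * P c0 0)) - f * c0 * P c0 0)%C by ring.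
      rewrite E0. ring. }
    assert (EI : I = (- (RtoC (T 0) * l * p0 0 ^ 2) / (c0 ^ 2 * P c0 0))%C).
    { rewrite HI. field. split; assumption. }
    assert (Em : m = (- (f * c0 * P c0 0) / l)%C)
      by (rewrite <- E1; field; exact Hl).
    unfold K, sens_K. fold I. rewrite Em, EI. unfold f.
    field. repeat split; assumption. }
  subst m. split.
  (* Constant and radius come from the tangent of the branch alone, hence are uniform in the phases
     of A and K; |Im z| <= |z| transfers the bound to the growth rate. *)
  - destruct Hm as [B1 [r1 [Hr1 H1]]].
    exists (alpha * B1), r1. split; [exact Hr1 |].
    intros A phi phiK _ HA HphiA HphiK. specialize (H1 A).
    replace (A - 0)%C with A in H1 by ring. specialize (H1 HA).
    rewrite HcA0 in H1.
    assert (Eshift : shift A phi phiK = alpha * Im (K * A)%C).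
    { unfold shift. rewrite HphiA at 2. rewrite (Im_mult_cis _ _ _ _ HphiK). ring. }
    rewrite Eshift.
    replace (alpha * Im (cA A - c0)%C - alpha * Im (K * A)%C)
      with (alpha * Im (cA A - c0 - K * A)%C) by (unfold Im; simpl; ring).
    rewrite Rabs_mult, (Rabs_pos_eq alpha) by lra. rewrite Rmult_assoc.
    apply Rmult_le_compat_l; [lra |].
    eapply Rle_trans; [| exact H1].
    eapply Rle_trans; [apply Rmax_r | apply Rmax_Cmod].
  - intros A phi phiK HA _ HphiK.
    assert (HAp : 0 < Cmod A) by (apply Cmod_gt_0, HA).
    assert (HKp : 0 < Cmod K) by (apply Cmod_gt_0, HK).
    assert (EIm : Im (K * cis phi)%C = Cmod K * sin (phi + phiK)).
    { replace (cis phi) with (RtoC 1 * cis phi)%C by ring.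
      rewrite (Im_mult_cis _ _ _ _ HphiK). ring. }
    assert (Hsign : Cmod K * sin (phi + phiK) < 0 <-> sin (phi + phiK) < 0)
      by (split; intros; nra).
    rewrite EIm. split.
    + rewrite Hsign. unfold shift.
      assert (0 < alpha * Cmod K * Cmod A) by (repeat apply Rmult_lt_0_compat; lra).
      split; intros; nra.
    + rewrite Hsign, sin_neg_iff.
      split; intros [k Hk]; exists k; lra.
Qed.
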